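(* Let $\tilde{F}^n$ (exact solution of the fully discrete Crank--Nicolson leap-frog scheme for the Boltzmann-BGK equation, with $D=3$) and $F^n$ (the APTT solution computed with TT-SVD tolerance $\varepsilon_b$ and TT-MALS tolerance $\varepsilon_d$) be as in the context, and put $\varepsilon_n=\|\tilde{F}^n-F^n\|_F$. Assume: (A1) there are constants $\underline{\rho},\underline{T}>0$ with $0<\underline{\rho}\le\tilde{\rho}^n_{\bm{k}}$ and $0<\underline{T}\le\tilde{T}^n_{\bm{k}}$ for all $\bm{k}$ and $n$; (A2) $\|\tilde{F}^n\|_\infty\le C$ for all $n$; (A3) the time step size $\Delta t$ is small enough that $\|(\mathcal{I}-\Delta t\mathcal{L})^{-1}\|_F=\kappa_1\le C$ and $\|\mathcal{I}+\Delta t\mathcal{L}\|_F=\kappa_2\le C$; (A4) the constants $C$ in (A2), (A3) and in the conclusions are independent of the time step size $\Delta t$ and of the tolerances $\varepsilon_b$ and $\varepsilon_d$. Then, for small enough $h$ satisfying $h^{3/2}\varepsilon_n\le\underline{\rho}/2$ (for the time levels $n$ under consideration), $$\varepsilon_{n+1}\le\varepsilon_{n-1}+C\Delta t(\varepsilon_{n-1}+\varepsilon_n+\varepsilon_b)+C(\varepsilon_b+\varepsilon_d),$$ where $C$ is a constant independent of $\varepsilon_n$, $\varepsilon_b$ and $\varepsilon_d$. Furthermore, if $\varepsilon_b=\varepsilon_d=(\Delta t)^{1+\varpi}$ with $\varpi>0$, then $$\varepsilon_{n+1}\le C\,n(\Delta t)^{1+\varpi}\le C(\Delta t)^{\varpi}.$$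 Here $n\ge1$ with $n<t^\star/\Delta t$.
   Context: **Grid.** Let $m\ge1$ be an integer, $h=2\pi/m$, $\Delta t>0$, $t_n=n\Delta t\le t^\star$ with $t^\star$ a fixed final time, and let $\mathrm{Kn},\mathrm{Bo},K>0$ and $\mu\in\mathbb{R}$ be fixed. For multi-indices $\bm{k}=(k_1,k_2,k_3),\bm{l}=(l_1,l_2,l_3)\in\{0,\dots,m-1\}^3$ put $\bm{x}^{\bm{k}}=h\bm{k}-(\pi,\pi,\pi)$ and $\bm{v}^{\bm{l}}=h\bm{l}-(\pi,\pi,\pi)$, with components $v_i^{l_i}=hl_i-\pi$. Sixth-order tensors $F=(F_{\bm{k},\bm{l}})\in\mathbb{R}^{m\times\cdots\times m}$ represent the density on this grid, periodic in $\bm{k}$ (indices mod $m$). $\|\cdot\|_F$ is the Frobenius norm, $\|\cdot\|_\infty$ the maximum absolute entry, $\odot$ the entrywise (Hadamard) product. **Macroscopic quantities of a tensor $F$.** $$\rho_{\bm{k}}=h^3\sum_{\bm{l}}F_{\bm{k},\bm{l}},\quad \bm{U}_{\bm{k}}=\frac{h^3}{\rho_{\bm{k}}}\sum_{\bm{l}}\bm{v}^{\bm{l}}F_{\bm{k},\bm{l}},\quad T_{\bm{k}}=\frac{\mathrm{Bo}\,h^3}{3\rho_{\bm{k}}}\sum_{\bm{l}}\|\bm{v}^{\bm{l}}-\bm{U}_{\bm{k}}\|_2^2F_{\bm{k},\bm{l}},\quad \nu_{\bm{k}}=K\rho_{\bm{k}}T_{\bm{k}}^{1-\mu}.$$ With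 $U_{i,\bm{k}}$ the $i$-th component of $\bm{U}_{\bm{k}}$, put $$[F_{\rm eq}^{i}]_{\bm{k},l_i}=\frac{\rho_{\bm{k}}^{1/3}}{(2\pi T_{\bm{k}}/\mathrm{Bo})^{1/2}}\exp\Big(-\mathrm{Bo}\frac{(v_i^{l_i}-U_{i,\bm{k}})^2}{2T_{\bm{k}}}\Big),\ i=1,2,3,\qquad [F_{\rm eq}]_{\bm{k},\bm{l}}=\prod_{i=1}^3[F^i_{\rm eq}]_{\bm{k},l_i},$$ and the exact discrete collision tensor $Q_{\bm{k},\bm{l}}=\frac{\nu_{\bm{k}}}{\mathrm{Kn}}([F_{\rm eq}]_{\bm{k},\bm{l}}-F_{\bm{k},\bm{l}})$. **Transport operator.** $\mathcal{I}$ is the identity and $\mathcal{L}$ is the linear operator $$(\mathcal{L}F)_{\bm{k},\bm{l}}=-\sum_{i=1}^3\Big(\max(v_i^{l_i},0)\tfrac{3F_{\bm{k},\bm{l}}-4F_{\bm{k}-\bm{e}_i,\bm{l}}+F_{\bm{k}-2\bm{e}_i,\bm{l}}}{2h}-\min(v_i^{l_i},0)\tfrac{3F_{\bm{k},\bm{l}}-4F_{\bm{k}+\bm{e}_i,\bm{l}}+F_{\bm{k}+2\bm{e}_i,\bm{l}}}{2h}\Big),$$ where $\bm{e}_1,\bm{e}_2,\bm{e}_3$ are the standard unit vectors. **Exact discrete solution (tilde).** $\tilde{F}^0_{\bm{k},\bm{l}}=f_0(\bm{x}^{\bm{k}},\bm{v}^{\bm{l}})$ for the initial density $f_0$; $\tilde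 F^1$ is the start-up value given by $\hat F^1=F^0+\Delta t(\mathcal{L}F^0+Q^0)$, $F^1=\frac12F^0+\frac12\hat F^1+\frac12\Delta t(\mathcal{L}\hat F^1+\hat Q^1)$ applied to $\tilde F^0$ (where $\hat Q^1$ is the collision tensor of $\hat F^1$); and for $n\ge1$ $$(\mathcal{I}-\Delta t\mathcal{L})\tilde{F}^{n+1}=(\mathcal{I}+\Delta t\mathcal{L})\tilde{F}^{n-1}+2\Delta t\,\tilde{Q}^n .$$ $\tilde\rho^n,\tilde{\bm U}^n,\tilde T^n,\tilde\nu^n,\tilde F^n_{\rm eq},\tilde Q^n$ denote the tensors $\rho,\bm{U},T,\nu,F_{\rm eq},Q$ evaluated for $F=\tilde F^n$. **Tensor-train (TT) format and recompression.** A $d$th-order tensor $A$ is in TT format with TT-rank $(r_1,\dots,r_{d-1})$ if $A_{i_1,\dots,i_d}=\sum_{\alpha_1,\dots,\alpha_{d-1}}A^1_{i_1,\alpha_1}A^2_{\alpha_1,i_2,\alpha_2}\cdots A^d_{\alpha_{d-1},i_d}$ with cores $A^1\in\mathbb{R}^{I_1\times r_1}$, $A^j\in\mathbb{R}^{r_{j-1}\times I_j\times r_j}$, $A^d\in\mathbb{R}^{r_{d-1}\times I_d}$. Recompression of $A$ with tolerance $\varepsilon_b\in(0,1)$ (by the classical TT-SVD / TT-rounding algorithm) replaces $A$ by a TT tensor $B$ of low (lowest possible) TT-rank with $\|A-B\|_F\le\varepsilon_b\|A\|_F$. **TT collision term $Q^n$.** From the TT tensor $F^n$, compute $\rho^n_{\bm{k}}=h^3\sum_{\bm{l}}F^n_{\bm{k},\bm{l}}$,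 $\bm{U}^n_{\bm{k}}=\frac{h^3}{\rho^n_{\bm{k}}}\sum_{\bm{l}}\bm{v}^{\bm{l}}F^n_{\bm{k},\bm{l}}$, $T^n_{\bm{k}}=\frac{\mathrm{Bo}\,h^3}{3\rho^n_{\bm{k}}}\sum_{\bm{l}}\|\bm{v}^{\bm{l}}-\bm{U}^n_{\bm{k}}\|_2^2F^n_{\bm{k},\bm{l}}$ and the fourth-order tensors $[F^{i,n}_{\rm eq}]_{\bm{k},l_i}=\frac{(\rho^n_{\bm{k}})^{1/3}}{(2\pi T^n_{\bm{k}}/\mathrm{Bo})^{1/2}}\exp\big(-\mathrm{Bo}\frac{(v_i^{l_i}-U^n_{i,\bm{k}})^2}{2T^n_{\bm{k}}}\big)$, $i=1,2,3$. Recompress each into a TT tensor $\mathbb{TT}(F^{i,n}_{\rm eq})$ with tolerance $\varepsilon_b$, and expand it to the sixth-order tensor $E^{i,n}_{\bm{k},\bm{l}}=[\mathbb{TT}(F^{i,n}_{\rm eq})]_{\bm{k},l_i}$. Put $F^n_{\rm eq}=E^{1,n}\odot E^{2,n}\odot E^{3,n}$. Similarly, the third-order collision-frequency tensor $K\rho^n(T^n)^{1-\mu}$ is converted (same recompression and expansion, constant in $\bm{l}$) to a sixth-order TT tensor $\nu^n$. Then $Q^n=\frac{1}{\mathrm{Kn}}\,\nu^n\odot(F^n_{\rm eq}-F^n)$. **APTT solution $F^n$.** $F^0$ is the recompression of $\tilde F^0$ with tolerance $\varepsilon_b$; $F^1$ is obtained from $F^0$ by $\hat F^1=F^0+\Delta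 t(\mathcal{L}F^0+Q^0)$, $F^1=\frac12F^0+\frac12\hat F^1+\frac12\Delta t(\mathcal{L}\hat F^1+\hat Q^1)$, where $Q^0$ and $\hat Q^1$ are the TT collision terms constructed from $F^0$ and $\hat F^1$; for $n\ge1$, $R$ denotes the recompression with tolerance $\varepsilon_b$ of $(\mathcal{I}+\Delta t\mathcal{L})F^{n-1}+2\Delta tQ^n$, and $F^{n+1}$ is the output of an iterative low-rank solver (TT-MALS) for $(\mathcal{I}-\Delta t\mathcal{L})F^{n+1}=R$ terminated when $\|(\mathcal{I}-\Delta t\mathcal{L})F^{n+1}-R\|_F\le\varepsilon_d$.
   Formalization: ''Small enough h'' is rendered as h^{3/2}ε_j ≤ c_0, besides h^{3/2}ε_j ≤ ρ̲/2, with c_0>0 depending only on the data and the constants in (A1)–(A3); the latter condition alone does not keep T^n away from 0, so the estimate can fail for any h. *)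

(* Defs.v *)
From HB Require Import structures.
From mathcomp Require Import all_boot all_order all_algebra.
From mathcomp Require Import all_classical all_reals all_analysis.
Set Implicit Arguments.
Unset Strict Implicit.
Unset Printing Implicit Defensive.
Import Order.TTheory GRing.Theory Num.Theory.
Local Open Scope ring_scope.

(* Tensors of order d, all of whose modes have size m. A sixth-order index is
   the concatenation [row_mx k l] of a space and a velocity multi-index; a
   fourth-order one is a space multi-index followed by one velocity index. *)
Definition mindex (d m : nat) := 'rV['I_m]_d.
Definition tensor (R : realType) (d m : nat) := mindex d m -> R.

Definition frob (R : realType) (d m : nat) (A : tensor R d m) : R :=
  Num.sqrt (\sum_i A i ^+ 2).

Definition maxabs (R : realType) (d m : nat) (A : tensor R d m) : R :=
  \big[Num.max/0]_i `|A i|.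

(* Operator norm induced by the Frobenius norm; it is bounded by the Frobenius
   norm of the matrix of S. *)
Definition opfrob (R : realType) (d m : nat)
    (S : tensor R d m -> tensor R d m) : R :=
  sup [set frob (S X) | X in [set X : tensor R d m | frob X <= 1]]%classic.

Record bgk_params (R : realType) :=
  BGKParams { Kn : R; Bo : R; Kfreq : R; mu : R }.

Definition mesh (R : realType) (m : nat) : R := 2 * pi / m%:R.

(* The same nodes serve for the spatial and for the velocity grid. *)
Definition node (R : realType) (m : nat) (k : mindex 3 m) : 'rV[R]_3 :=
  \row_i (mesh R m * (k 0 i)%:R - pi).

Section Macroscopic.
Variables (R : realType) (p : bgk_params R) (m : nat).
Implicit Types (F : tensor R (3 + 3) m) (k l : mindex 3 m).

Definition rho F k : R := mesh R m ^+ 3 * \sum_l F (row_mx k l).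

Definition velo F k : 'rV[R]_3 :=
  (mesh R m ^+ 3 / rho F k) *: \sum_l F (row_mx k l) *: node R l.

Definition temp F k : R :=
  Bo p * mesh R m ^+ 3 / (3 * rho F k) *
  \sum_l (\sum_i (node R l 0 i - velo F k 0 i) ^+ 2) * F (row_mx k l).

Definition nu F : tensor R 3 m :=
  fun k => Kfreq p * rho F k * temp F k `^ (1 - mu p).

Definition feq (i : 'I_3) F : tensor R (3 + 1) m := fun q =>
  let k : mindex 3 m := lsubmx q in
  let v : R := mesh R m * (rsubmx q 0 0)%:R - pi in
  rho F k `^ 3^-1 / Num.sqrt (2 * pi * temp F k / Bo p) *
  expR (- (Bo p * (v - velo F k 0 i) ^+ 2 / (2 * temp F k))).

Definition expand4 (i : 'I_3) (E : tensor R (3 + 1) m) : tensor R (3 + 3) m :=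
  fun q => E (row_mx (lsubmx q) (const_mx (rsubmx q 0 i))).

Definition expand3 (N : tensor R 3 m) : tensor R (3 + 3) m :=
  fun q => N (lsubmx q).

Definition collision_of (N : tensor R 3 m) (E : 'I_3 -> tensor R (3 + 1) m) F :
    tensor R (3 + 3) m :=
  fun q => (Kn p)^-1 * expand3 N q * (\prod_i expand4 i (E i) q - F q).

Definition collision F : tensor R (3 + 3) m :=
  collision_of (nu F) (fun i => feq i F) F.

End Macroscopic.

(* k - e_i and k + e_i, componentwise modulo m. *)
Definition kpred (m : nat) (i : 'I_3) (k : mindex 3 m) : mindex 3 m :=
  \row_j (if j == i then ord_pred (k 0 j) else k 0 j).
Definition ksucc (m : nat) (i : 'I_3) (k : mindex 3 m) : mindex 3 m :=
  \row_j (if j == i then ordS (k 0 j) else k 0 j).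

Definition transport (R : realType) (m : nat) (F : tensor R (3 + 3) m) :
    tensor R (3 + 3) m := fun q =>
  let k : mindex 3 m := lsubmx q in
  let l : mindex 3 m := rsubmx q in
  let v := node R l in
  let h := mesh R m in
  - \sum_(i < 3)
     (Num.max (v 0 i) 0 *
        ((3 * F (row_mx k l) - 4 * F (row_mx (kpred i k) l)
          + F (row_mx (kpred i (kpred i k)) l)) / (2 * h))
      - Num.min (v 0 i) 0 *
        ((3 * F (row_mx k l) - 4 * F (row_mx (ksucc i k) l)
          + F (row_mx (ksucc i (ksucc i k)) l)) / (2 * h))).

Definition op_minus (R : realType) (m : nat) (dt : R) (F : tensor R (3 + 3) m) :
    tensor R (3 + 3) m := fun q => F q - dt * transport F q.
Definition op_plus (R : realType) (m : nat) (dt : R) (F : tensor R (3 + 3) m) :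
    tensor R (3 + 3) m := fun q => F q + dt * transport F q.

Definition euler_stage (R : realType) (m : nat) (dt : R)
    (F0 Q0 : tensor R (3 + 3) m) : tensor R (3 + 3) m :=
  fun q => F0 q + dt * (transport F0 q + Q0 q).
Definition heun_stage (R : realType) (m : nat) (dt : R)
    (F0 Fhat Qhat : tensor R (3 + 3) m) : tensor R (3 + 3) m :=
  fun q => 2^-1 * F0 q + 2^-1 * Fhat q
           + 2^-1 * dt * (transport Fhat q + Qhat q).

Definition leapfrog_rhs (R : realType) (m : nat) (dt : R)
    (G Q : tensor R (3 + 3) m) : tensor R (3 + 3) m :=
  fun q => op_plus dt G q + 2 * dt * Q q.

Definition exact_solution (R : realType) (p : bgk_params R)
    (f0 : 'rV[R]_3 -> 'rV[R]_3 -> R) (tstar : R) (m : nat) (dt : R)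
    (F : nat -> tensor R (3 + 3) m) : Prop :=
  [/\ forall k l, F 0 (row_mx k l) = f0 (node R k) (node R l),
      (let Fhat := euler_stage dt (F 0) (collision p (F 0)) in
       F 1 = heun_stage dt (F 0) Fhat (collision p Fhat))
    & forall n, (1 <= n)%N -> n%:R * dt < tstar ->
      op_minus dt (F n.+1) = leapfrog_rhs dt (F n.-1) (collision p (F n))].

(* A has a tensor-train decomposition with ranks r_1, ..., r_(d-1); the
   boundary ranks r_0 and r_d are 1, so the first and last cores are matrices.
   The sum ranges over all rank indices (alpha_0, ..., alpha_d). *)
Definition tt_format (R : realType) (d m : nat) (r : 'I_d.+1 -> nat)
    (A : tensor R d m) : Prop :=
  [/\ r ord0 = 1%N, r ord_max = 1%N
    & exists G : forall j : 'I_d,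
        'I_(r (widen_ord (leqnSn d) j)) -> 'I_m -> 'I_(r (lift ord0 j)) -> R,
      forall i, A i =
        \sum_(al : {dffun forall j : 'I_d.+1, 'I_(r j)})
          \prod_(j < d) G j (al _) (i 0 j) (al _)].

Definition tt_tensor (R : realType) (d m : nat) (A : tensor R d m) : Prop :=
  exists r : 'I_d.+1 -> nat, tt_format r A.

(* B is an admissible output of the recompression of A with tolerance eps.
   The relation leaves the TT-ranks of B free: it holds for the output of
   TT-SVD as well as for that of any rank-minimising truncation. *)
Definition recompression (R : realType) (d m : nat) (eps : R)
    (A B : tensor R d m) : Prop :=
  tt_tensor B /\ frob (A \- B) <= eps * frob A.

Definition tt_collision (R : realType) (p : bgk_params R) (m : nat) (eb : R)
    (F Q : tensor R (3 + 3) m) : Prop :=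
  exists (N : tensor R 3 m) (E : 'I_3 -> tensor R (3 + 1) m),
    [/\ recompression eb (nu p F) N,
        forall i, recompression eb (feq p i F) (E i)
      & Q = collision_of p N E F].

(* F is any sequence of tensors compatible with the algorithm; the iterative solver is represented by its stopping criterion. *)
Definition aptt_solution (R : realType) (p : bgk_params R)
    (tstar : R) (m : nat) (dt eb ed : R) (Ft0 : tensor R (3 + 3) m)
    (F : nat -> tensor R (3 + 3) m) : Prop :=
  [/\ recompression eb Ft0 (F 0),
      (exists Q0 Qhat : tensor R (3 + 3) m,
         let Fhat := euler_stage dt (F 0) Q0 in
         [/\ tt_collision p eb (F 0) Q0, tt_collision p eb Fhat Qhat
           & F 1 = heun_stage dt (F 0) Fhat Qhat])
    & forall n, (1 <= n)%N -> n%:R * dt < tstar ->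
      exists Q rhs : tensor R (3 + 3) m,
        [/\ tt_collision p eb (F n) Q,
            recompression eb (leapfrog_rhs dt (F n.-1) Q) rhs,
            tt_tensor (F n.+1)
          & frob (op_minus dt (F n.+1) \- rhs) <= ed]].

Definition macro_lower_bounds (R : realType) (p : bgk_params R) (tstar : R)
    (m : nat) (dt rhol Tl : R) (Ft : nat -> tensor R (3 + 3) m) : Prop :=
  forall n, n%:R * dt <= tstar ->
  forall k, rhol <= rho (Ft n) k /\ Tl <= temp p (Ft n) k.

Definition uniformly_bounded (R : realType) (tstar : R) (m : nat) (dt C : R)
    (Ft : nat -> tensor R (3 + 3) m) : Prop :=
  forall n, n%:R * dt <= tstar -> maxabs (Ft n) <= C.

Definition step_bounds (R : realType) (m : nat) (dt C : R) : Prop :=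
  (exists S : tensor R (3 + 3) m -> tensor R (3 + 3) m,
     [/\ cancel (@op_minus R m dt) S, cancel S (@op_minus R m dt)
       & opfrob S <= C])
  /\ opfrob (@op_plus R m dt) <= C.

(* Main.v *)
Require Import Defs.
From HB Require Import structures.
From mathcomp Require Import all_boot all_order all_algebra.
From mathcomp Require Import all_classical all_reals all_analysis.
From mathcomp Require Import ring lra.
Import Order.TTheory GRing.Theory Num.Theory.
Local Open Scope ring_scope.

(* With [X = Ft (n-1) - F (n-1)] and [Y = Ft (n+1) - F (n+1)], subtracting the
   two schemes gives [(I - dt L) (Y - X) = 2 dt L X + 2 dt (Qt - Q) + residuals],
   so that [(A3)] bounds the growth factor of [X] by [1 + C dt], with [C]
   depending on the mesh through the norm of [L]. The term [Qt - Q] is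
   controlled because the collision operator is Lipschitz on the tensors whose
   density and temperature are bounded below: it is built from finitely many
   linear functionals by operations that preserve boundedness and the Lipschitz
   property there. Smallness of [h^(3/2) err] keeps [F] in this set, uniformly in
   the mesh. The intermediate Euler stage of the start-up step, for which nothing
   is assumed, lies in this set when [dt] is small; when it is not, the second
   estimate only asks for boundedness. The rest is a discrete Gronwall argument. *)

(** * Bounded Lipschitz functions and the Frobenius norm *)

(** A single constant serves as bound and as Lipschitz constant, since closure under products needs
    both. Both [D] and [d] are left general: points will be vectors of moments, tensors, and triples
    of tensors. *)
Definition bounded_lipschitz {R : realType} {T : Type} (D : T -> Prop)
    (d : T -> T -> R) (f : T -> R) : Prop :=
  exists2 M : R, 0 <= M & forall x y, D x -> D y ->
    `|f x| <= M /\ `|f x - f y| <= M * d x y.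

Section BoundedLipschitz.
Context {R : realType} {T : Type} {D : T -> Prop} {d : T -> T -> R}.
Hypothesis d_ge0 : forall x y, 0 <= d x y.

Local Notation blip := (@bounded_lipschitz R T D d).

Lemma blip_eq {f g} : (forall x, D x -> f x = g x) -> blip g -> blip f.
Proof.
by move=> fg [M M0 H]; exists M => // x y Dx Dy; rewrite !fg//; exact: H.
Qed.

Lemma blip_cst c : blip (fun=> c).
Proof.
by exists `|c| => // x y _ _; rewrite subrr normr0 mulr_ge0.
Qed.

Lemma blipD {f g} : blip f -> blip g -> blip (fun x => f x + g x).
Proof.
move=> [M M0 Hf] [N N0 Hg]; exists (M + N); first exact: addr_ge0.
move=> x y Dx Dy; have [f1 f2] := Hf _ _ Dx Dy; have [g1 g2] := Hg _ _ Dx Dy.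
split; first by rewrite (le_trans (ler_normD _ _))// lerD.
by rewrite opprD addrACA mulrDl (le_trans (ler_normD _ _))// lerD.
Qed.

Lemma blipM {f g} : blip f -> blip g -> blip (fun x => f x * g x).
Proof.
move=> [M M0 Hf] [N N0 Hg]; exists (2 * M * N); first by rewrite !mulr_ge0.
move=> x y Dx Dy; have [f1 f2] := Hf _ _ Dx Dy.
have [g1 _] := Hg _ _ Dy Dx; have [g0 g2] := Hg _ _ Dx Dy.
have MN : 0 <= M * N by rewrite mulr_ge0.
split.
  by rewrite normrM (le_trans (ler_pM _ _ f1 g0))//; lra.
have -> : f x * g x - f y * g y = f x * (g x - g y) + (f x - f y) * g y by ring.
have -> : 2 * M * N * d x y = M * (N * d x y) + M * d x y * N by ring.
by rewrite (le_trans (ler_normD _ _))// !normrM lerD// ler_pM.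
Qed.

Lemma blipN {f} : blip f -> blip (fun x => - f x).
Proof.
move=> /(blipM (blip_cst (-1))); apply: blip_eq => x _.
by rewrite mulN1r.
Qed.

Lemma blipB {f g} : blip f -> blip g -> blip (fun x => f x - g x).
Proof. by move=> ? ?; apply: blipD => //; exact: blipN. Qed.

Lemma blipX {f} n : blip f -> blip (fun x => f x ^+ n).
Proof.
move=> Hf; elim: n => [|n IH]; first exact: (blip_cst 1).
by apply: (@blip_eq _ (fun x => f x * f x ^+ n)); [move=> x _; rewrite exprS|exact: blipM].
Qed.

Lemma blip_sum {I : Type} (s : seq I) {f : I -> T -> R} :
  (forall i, blip (f i)) -> blip (fun x => \sum_(i <- s) f i x).
Proof.
move=> Hf; elim: s => [|i s IH].
  by apply: (@blip_eq _ (fun=> 0)) (blip_cst 0) => x _; rewrite big_nil.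
by apply: (@blip_eq _ _ _ (blipD (Hf i) IH)) => x _; rewrite big_cons.
Qed.

Lemma blip_prod {I : Type} (s : seq I) {f : I -> T -> R} :
  (forall i, blip (f i)) -> blip (fun x => \prod_(i <- s) f i x).
Proof.
move=> Hf; elim: s => [|i s IH].
  by apply: (@blip_eq _ (fun=> 1)) (blip_cst 1) => x _; rewrite big_nil.
by apply: (@blip_eq _ _ _ (blipM (Hf i) IH)) => x _; rewrite big_cons.
Qed.

(** On [[-M, M]] the exponential has slope at most [expR M], which the tangent inequality yields
    without any differentiation. *)
Lemma blip_expR {f} : blip f -> blip (fun x => expR (f x)).
Proof.
move=> [M M0 Hf]; have e0 := expR_ge0 M.
exists (expR M * (1 + M)); first by rewrite mulr_ge0// addr_ge0.
have expM x y : D x -> D y -> expR (f x) <= expR M.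
  by move=> Dx Dy; rewrite ler_expR; have [/ler_normlP[]] := Hf _ _ Dx Dy.
have expL x y : D x -> D y ->
    expR (f x) - expR (f y) <= expR M * `|f x - f y|.
  move=> Dx Dy; have ex := expR_ge0 (f x).
  (* the graph of the convex function [expR] lies above its tangent at [f x] *)
  have := ler_wpM2l ex (expR_ge1Dx (f y - f x)).
  rewrite -expRD subrKC => h1.
  have h2 := ler_wpM2l ex (ler_norm (f x - f y)).
  have h3 := ler_wpM2r (normr_ge0 (f x - f y)) (expM _ _ Dx Dy).
  lra.
move=> x y Dx Dy; split.
  rewrite ger0_norm ?expR_ge0// (le_trans (expM _ _ Dx Dy))//.
  by rewrite ler_peMr// lerDl.
have [_ fxy] := Hf _ _ Dx Dy.
apply: (@le_trans _ _ (expR M * `|f x - f y|)).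
  by rewrite ler_norml lerNl opprB expL// distrC expL.
rewrite -mulrA ler_wpM2l// (le_trans fxy)// mulrDl mul1r lerDr.
exact: d_ge0.
Qed.

(** The difference of two inverses is [(f y - f x) / (f x * f y)], and each inverse is at most
    [a^-1]. *)
Lemma blipV {a f} : 0 < a -> (forall x, D x -> a <= f x) -> blip f ->
  blip (fun x => (f x)^-1).
Proof.
move=> a0 fa [M M0 Hf]; have ai0 : 0 < a^-1 by rewrite invr_gt0.
have fi x : D x -> 0 <= (f x)^-1 <= a^-1.
  move=> Dx; have fx0 := lt_le_trans a0 (fa _ Dx).
  by rewrite invr_ge0 (ltW fx0) lef_pV2 ?posrE// fa.
exists (a^-1 + M * a^-1 * a^-1).
  by rewrite addr_ge0 ?mulr_ge0// ltW.
move=> x y Dx Dy; have [_ fxy] := Hf _ _ Dx Dy.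
have /andP[x0 xa] := fi _ Dx; have /andP[y0 ya] := fi _ Dy.
have d0 := d_ge0 x y.
split; first by rewrite ger0_norm// (le_trans xa)// lerDl !mulr_ge0// ltW.
have fx0 := lt_le_trans a0 (fa _ Dx); have fy0 := lt_le_trans a0 (fa _ Dy).
have -> : (f x)^-1 - (f y)^-1 = (f y - f x) * (f x)^-1 * (f y)^-1.
  by field; rewrite !gt_eqF.
rewrite !normrM distrC (ger0_norm x0) (ger0_norm y0).
apply: (@le_trans _ _ (M * d x y * a^-1 * a^-1)).
  by rewrite !ler_pM// mulr_ge0.
rewrite mulrDl; set u := (X in _ <= _ + X).
have -> : u = M * d x y * a^-1 * a^-1 by rewrite /u; ring.
by rewrite lerDr mulr_ge0// ltW.
Qed.

(** The inequality [ln (1 + t) <= t] at [t = (f x - f y) / f y] gives the Lipschitz bound. The bound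
    on the values comes from [ln t <= t], applied to [f x] and to its inverse. *)
Lemma blip_ln {a f} : 0 < a -> (forall x, D x -> a <= f x) -> blip f ->
  blip (fun x => ln (f x)).
Proof.
move=> a0 fa Hf; have [N N0 HV] := blipV a0 fa Hf.
case: Hf => M M0 Hf.
exists (M + N + N * M); first by rewrite !addr_ge0// mulr_ge0.
have lnD x y : D x -> D y -> ln (f x) - ln (f y) <= (f x - f y) * (f y)^-1.
  move=> Dx Dy; have fx0 := lt_le_trans a0 (fa _ Dx).
  have fy0 := lt_le_trans a0 (fa _ Dy).
  rewrite -ln_div ?posrE//.
  have -> : f x / f y = 1 + (f x - f y) / f y by field; rewrite gt_eqF.
  apply: le_ln1Dx; rewrite mulrBl divff ?gt_eqF// ltrBrDr addNr.
  exact: divr_gt0.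
move=> x y Dx Dy; have fx0 := lt_le_trans a0 (fa _ Dx).
have [fM fxy] := Hf _ _ Dx Dy; have [VxN _] := HV _ _ Dx Dy.
have [VyN _] := HV _ _ Dy Dx; have d0 := d_ge0 x y.
have NM : 0 <= N * M by rewrite mulr_ge0.
split.
  have h1 := ln_sublinear fx0.
  have h2 : - ln (f x) <= (f x)^-1.
    by rewrite -lnV ?posrE// ltW// ln_sublinear// invr_gt0.
  move: fM VxN; rewrite !ler_norml => /andP[? ?] /andP[? ?]; apply/andP; split; lra.
have h u z : `|u| <= M * d x y -> `|z| <= N -> u * z <= N * M * d x y.
  move=> hu hz; apply: le_trans (ler_norm _) _; rewrite normrM.
  by rewrite -mulrA [leRHS]mulrC ler_pM.
have h1 := le_trans (lnD _ _ Dx Dy) (h _ _ fxy VyN).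
rewrite distrC in fxy.
have h2 := le_trans (lnD _ _ Dy Dx) (h _ _ fxy VxN).
have h3 : N * M * d x y <= (M + N + N * M) * d x y.
  by rewrite ler_wpM2r// lerDr addr_ge0.
by rewrite ler_norml; apply/andP; split; lra.
Qed.

(** For a base bounded away from zero the power is [expR (r * ln (f x))], so exponents of either
    sign are covered, in particular [1 - mu p]. *)
Lemma blip_powR {a f} r : 0 < a -> (forall x, D x -> a <= f x) -> blip f ->
  blip (fun x => f x `^ r).
Proof.
move=> a0 fa Hf.
have := blip_expR (blipM (blip_cst r) (blip_ln a0 fa Hf)).
apply: blip_eq => x Dx; rewrite /powR gt_eqF//; exact: lt_le_trans (fa _ Dx).
Qed.

Lemma blip_sqrt {a f} : 0 < a -> (forall x, D x -> a <= f x) -> blip f ->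
  blip (fun x => Num.sqrt (f x)).
Proof.
move=> a0 fa /(blip_powR 2^-1 a0 fa); apply: blip_eq => x Dx.
by rewrite powR12_sqrt// (le_trans (ltW a0))// fa.
Qed.

End BoundedLipschitz.

(** * Elementary inequalities for the Frobenius norm *)

Section Frobenius.
Context {R : realType} {d m : nat}.
Implicit Types A B : tensor R d m.

Lemma frob_ge0 A : 0 <= frob A.
Proof. exact: sqrtr_ge0. Qed.

Lemma sqr_frob A : frob A ^+ 2 = \sum_i A i ^+ 2.
Proof. by rewrite sqr_sqrtr// sumr_ge0// => i _; rewrite sqr_ge0. Qed.

Lemma frob_entry A i : `|A i| <= frob A.
Proof.
rewrite -(@ler_pXn2r _ 2)// ?nnegrE ?frob_ge0// sqr_frob real_normK ?num_real//.
by rewrite (bigD1 i)//= lerDl sumr_ge0// => j _; rewrite sqr_ge0.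
Qed.

Lemma frobZ c A : frob (fun i => c * A i) = `|c| * frob A.
Proof.
rewrite /frob -sqrtr_sqr -sqrtrM ?sqr_ge0//; congr Num.sqrt.
by rewrite mulr_sumr; apply: eq_bigr => i _; rewrite exprMn.
Qed.

(** Expand the sum of squares of [frob B * A i - frob A * B i], which is nonnegative, and divide by
    [2 * frob A * frob B]; a factor of norm zero has only zero entries and is treated apart. *)
Lemma frob_cauchy_schwarz A B : \sum_i A i * B i <= frob A * frob B.
Proof.
have [/eqP A0|A0] := boolP (frob A == 0).
  rewrite big1 ?A0 ?mul0r// => i _.
  by have := frob_entry A i; rewrite A0 normr_le0 => /eqP ->; rewrite mul0r.
have [/eqP B0|B0] := boolP (frob B == 0).
  rewrite big1 ?B0 ?mulr0// => i _.
  by have := frob_entry B i; rewrite B0 normr_le0 => /eqP ->; rewrite mulr0.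
have AB : 0 < 2 * (frob A * frob B).
  by rewrite !mulr_gt0// lt_def ?A0 ?B0 frob_ge0.
have : 0 <= \sum_i (frob B * A i - frob A * B i) ^+ 2.
  by rewrite sumr_ge0// => i _; rewrite sqr_ge0.
have -> : \sum_i (frob B * A i - frob A * B i) ^+ 2 =
  2 * (frob A * frob B) * (frob A * frob B - \sum_i A i * B i).
  transitivity (frob B ^+ 2 * (\sum_i A i ^+ 2) + frob A ^+ 2 * (\sum_i B i ^+ 2)
                - 2 * (frob A * frob B) * \sum_i A i * B i).
    by rewrite !mulr_sumr -sumrN -!big_split/=; apply: eq_bigr => i _; ring.
  by rewrite -!sqr_frob; ring.
by rewrite pmulr_rge0// subr_ge0.
Qed.

Lemma frobD A B : frob (fun i => A i + B i) <= frob A + frob B.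
Proof.
rewrite -(@ler_pXn2r _ 2)// ?nnegrE ?frob_ge0 ?addr_ge0 ?frob_ge0//.
rewrite sqr_frob sqrrD !sqr_frob.
have -> : \sum_i (A i + B i) ^+ 2
   = \sum_i A i ^+ 2 + (\sum_i A i * B i) *+ 2 + \sum_i B i ^+ 2.
  by rewrite mulr2n -!big_split/=; apply: eq_bigr => i _; ring.
by rewrite lerD2r lerD2l lerMn2r frob_cauchy_schwarz orbT.
Qed.

Lemma frob_distC A B : frob (A \- B) = frob (B \- A).
Proof.
by rewrite /frob; congr Num.sqrt; apply: eq_bigr => i _ /=; rewrite -sqrrN opprB.
Qed.

Lemma frob_triangle B A C : frob (A \- C) <= frob (A \- B) + frob (B \- C).
Proof.
apply: le_trans (frobD _ _).
by rewrite le_eqVlt; apply/orP; left; apply/eqP; congr frob; apply/funext => i/=; ring.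
Qed.

Lemma frob_le_add A B : frob A <= frob B + frob (B \- A).
Proof.
rewrite [X in _ + X]frob_distC; apply: le_trans (frobD _ _).
by rewrite le_eqVlt; apply/orP; left; apply/eqP; congr frob; apply/funext => i/=; ring.
Qed.

Lemma frob_le_sum A : frob A <= \sum_i `|A i|.
Proof.
rewrite -(@ler_pXn2r _ 2)// ?nnegrE ?frob_ge0 ?sumr_ge0// sqr_frob.
have S0 : 0 <= \sum_i `|A i| by rewrite sumr_ge0.
rewrite expr2 mulr_suml; apply: ler_sum => i _.
rewrite -real_normK ?num_real// expr2 ler_wpM2l//.
by rewrite (bigD1 i)//= lerDl sumr_ge0.
Qed.

(** The crude factor, the number of entries instead of its square root, is harmless: it only enters
    constants that may depend on the mesh. *)
Lemma frob_le_maxabs A : frob A <= #|mindex d m|%:R * maxabs A.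
Proof.
apply: le_trans (frob_le_sum A) _.
rewrite mulr_natl -sumr_const; apply: ler_sum => i _.
exact: le_bigmax.
Qed.

End Frobenius.

(** Passage from entries to norms: the entrywise constants are summed, so the result depends on the
    number of entries. *)
Lemma blip_frob {R : realType} {T : Type} {D : T -> Prop} {dist : T -> T -> R}
    {d m : nat} {A : T -> tensor R d m} :
  (forall x y, 0 <= dist x y) ->
  (forall i, bounded_lipschitz D dist (fun x => A x i)) ->
  exists2 M : R, 0 <= M & forall x y, D x -> D y ->
    frob (A x) <= M /\ frob (A x \- A y) <= M * dist x y.
Proof.
move=> d0 HA; have /choice[M HM] : forall i, exists M, 0 <= M /\
    forall x y, D x -> D y -> `|A x i| <= M /\ `|A x i - A y i| <= M * dist x y.
  by move=> i; have [M M0 HM] := HA i; exists M.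
exists (\sum_i M i); first by rewrite sumr_ge0// => i _; have [] := HM i.
move=> x y Dx Dy; split; apply: le_trans (frob_le_sum _) _.
  by apply: ler_sum => i _; have [_ /(_ _ _ Dx Dy)[]] := HM i.
by rewrite mulr_suml; apply: ler_sum => i _; have [_ /(_ _ _ Dx Dy)[]] := HM i.
Qed.

(** * Velocity moments *)

Section Moments.
Context {R : realType} {m : nat}.
Implicit Types (F X : tensor R (3 + 3) m) (k l : mindex 3 m).

(** Density, momentum and energy are the instances with weights [1], [v_i] and [|v|^2]. Since
    moments are linear in [F], stability of the macroscopic quantities reduces to bounds on these
    weights. *)
Definition moment (g : mindex 3 m -> R) F k : R :=
  mesh R m ^+ 3 * \sum_l g l * F (row_mx k l).

Definition momentum F k (i : 'I_3) : R := moment (fun l => node R l 0 i) F k.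

Definition energy F k : R := moment (fun l => \sum_i node R l 0 i ^+ 2) F k.

Lemma rhoE F k : rho F k = moment (fun=> 1) F k.
Proof. by congr (_ * _); apply: eq_bigr => l _; rewrite mul1r. Qed.

Lemma momentB g F X k : moment g (F \- X) k = moment g F k - moment g X k.
Proof.
rewrite /moment -mulrBr -sumrB; congr (_ * _); apply: eq_bigr => l _ /=.
by rewrite mulrBr.
Qed.

Lemma veloE F k i : velo F k 0 i = momentum F k i / rho F k.
Proof.
rewrite /velo mxE summxE /momentum /moment mulrAC; congr (_ * _ / _).
by apply: eq_bigr => l _; rewrite mxE mulrC.
Qed.

(** Expanding [|v - U|^2] and inserting [U = momentum / rho] merges the cross term with the last one
    into [- rho * |U|^2]. The temperature becomes a rational function of five moments. *)
Lemma tempE p F k : rho F k != 0 -> temp p F k =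
  Bo p / 3 * (energy F k / rho F k - \sum_i (momentum F k i / rho F k) ^+ 2).
Proof.
move=> r0; rewrite /temp; set U := velo F k.
have -> : Bo p * mesh R m ^+ 3 / (3 * rho F k) *
    (\sum_l (\sum_i (node R l 0 i - U 0 i) ^+ 2) * F (row_mx k l)) =
    Bo p / (3 * rho F k) *
    moment (fun l => \sum_i (node R l 0 i - U 0 i) ^+ 2) F k.
  by rewrite /moment; ring.
have -> : moment (fun l => \sum_i (node R l 0 i - U 0 i) ^+ 2) F k =
    energy F k - \sum_i 2 * U 0 i * momentum F k i + \sum_i U 0 i ^+ 2 * rho F k.
  rewrite !big_ord_recr !big_ord0/= rhoE /energy /momentum /moment.
  rewrite !add0r.
  under eq_bigr do rewrite !big_ord_recr big_ord0/= add0r.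
  under [X in _ = _ * X - _ + _]eq_bigr do rewrite !big_ord_recr big_ord0/= add0r.
  rewrite !(mulrCA _ (mesh R m ^+ 3)) -!mulrDr -mulrBr -mulrDr; congr (_ * _).
  rewrite !mulr_sumr -!big_split/= -sumrB -big_split/=.
  by apply: eq_bigr => l _; ring.
have -> : energy F k - \sum_i 2 * U 0 i * momentum F k i
    + \sum_i U 0 i ^+ 2 * rho F k =
    energy F k - rho F k * \sum_i (momentum F k i / rho F k) ^+ 2.
  rewrite -addrA mulr_sumr -!sumrN -big_split/=; congr (_ + _).
  by apply: eq_bigr => i _; rewrite veloE; field.
by field.
Qed.

Hypothesis m_gt0 : (1 <= m)%N.

Lemma mesh_gt0 : 0 < mesh R m.
Proof. by rewrite divr_gt0 ?mulr_gt0 ?pi_gt0 ?ltr0n. Qed.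

Lemma mesh_mul : mesh R m * m%:R = 2 * pi.
Proof. by rewrite /mesh divfK// pnatr_eq0 -lt0n. Qed.

Lemma node_le l i : `|node R l 0 i| <= pi.
Proof.
rewrite mxE; have h0 := mesh_gt0; have := mesh_mul.
have : 0 <= mesh R m * (l 0 i)%:R by rewrite mulr_ge0 ?(ltW h0).
have : mesh R m * (l 0 i)%:R <= mesh R m * m%:R.
  by rewrite ler_wpM2l ?(ltW h0)// ler_nat ltnW.
by rewrite ler_norml => ? ? ?; apply/andP; split; lra.
Qed.

Lemma node_sqr_le l : `|\sum_i node R l 0 i ^+ 2| <= 3 * pi ^+ 2.
Proof.
rewrite ger0_norm; last by rewrite sumr_ge0// => i _; rewrite sqr_ge0.
have h i : node R l 0 i ^+ 2 <= pi ^+ 2.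
  by rewrite -real_normK ?num_real// ler_pXn2r ?nnegrE ?pi_ge0 ?node_le.
rewrite !big_ord_recr big_ord0/= add0r.
have := h (widen_ord (leqnSn 2) (widen_ord (leqnSn 1) ord_max)).
have := h (widen_ord (leqnSn 2) ord_max); have := h ord_max; lra.
Qed.

Lemma card_mindex : #|mindex 3 m|%:R = m%:R ^+ 3 :> R.
Proof. by rewrite card_mx card_ord -natrX. Qed.

Lemma pi_ge1 : 1 <= pi :> R.
Proof. by have := pi_ge2 R; lra. Qed.

(** There are [m^3] velocities, each of weight [h^3], and [h * m = 2 * pi]: the bound is uniform in
    [m]. *)
Lemma moment_le_maxabs g c F k : (forall l, `|g l| <= c) ->
  `|moment g F k| <= c * (2 * pi) ^+ 3 * maxabs F.
Proof.
move=> gc; have h0 := mesh_gt0.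
rewrite /moment normrM ger0_norm ?exprn_ge0 ?(ltW h0)//.
have -> : c * (2 * pi) ^+ 3 * maxabs F =
    mesh R m ^+ 3 * (c * maxabs F * #|mindex 3 m|%:R).
  by rewrite -mesh_mul card_mindex; ring.
rewrite ler_wpM2l ?exprn_ge0 ?(ltW h0)//.
apply: le_trans (ler_norm_sum _ _ _) _.
rewrite mulr_natr -sumr_const; apply: ler_sum => l _.
by rewrite normrM ler_pM//; exact: le_bigmax.
Qed.

(** This is where the scaling [h^(3/2)] of the error originates: Cauchy-Schwarz over the [m^3]
    velocities gives [h^3 * m^(3/2)], which equals [h^(3/2) * (2 * pi)^(3/2)]. *)
Lemma moment_le_frob g c X k : (forall l, `|g l| <= c) ->
  `|moment g X k| <= c * (2 * pi) ^+ 2 * (mesh R m `^ (3 / 2) * frob X).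
Proof.
move=> gc; have h0 := mesh_gt0; set H := mesh R m `^ (3 / 2).
have H0 : 0 < H by rewrite powR_gt0.
have H2 : mesh R m ^+ 3 = H ^+ 2.
  by rewrite -(powR_mulrn 2) ?powR_ge0// -powRrM -(powR_mulrn 3) ?(ltW h0)//
     divfK.
have c0 : 0 <= c by exact: le_trans (normr_ge0 _) (gc k).
have S1 : \sum_l `|X (row_mx k l)| <= frob X * Num.sqrt (m%:R ^+ 3).
  pose A : tensor R 3 m := fun l => `|X (row_mx k l)|.
  have -> : \sum_l `|X (row_mx k l)| = \sum_l A l * (fun=> 1) l.
    by apply: eq_bigr => l _; rewrite /A; ring.
  apply: le_trans (frob_cauchy_schwarz A (fun=> 1)) _.
  have -> : frob ((fun=> 1) : tensor R 3 m) = Num.sqrt (m%:R ^+ 3).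
    rewrite /frob -card_mindex -sumr_const; congr Num.sqrt.
    by apply: eq_bigr => l _; rewrite expr1n.
  rewrite ler_wpM2r ?sqrtr_ge0// ler_wsqrtr//.
  (* The velocity entries at the fixed position [k] form a slice of the full tensor; the squares
     outside the slice are discarded. *)
  rewrite [leRHS](bigID (fun q => lsubmx q == k))/=.
  rewrite [X in _ <= X + _](reindex_onto (row_mx k) rsubmx)/=; last first.
    by move=> q /eqP <-; rewrite hsubmxK.
  rewrite [X in _ <= X + _](eq_bigl predT) => [|l]; last by rewrite row_mxKl row_mxKr !eqxx.
  rewrite [X in _ <= X + _](eq_bigr (fun l => A l ^+ 2)) => [|l _]; last first.
    by rewrite real_normK ?num_real.
  by rewrite lerDl sumr_ge0// => q _; rewrite sqr_ge0.
(* The exact value is [(2 * pi)^(3/2)]; since [2 * pi > 1] it is rounded up to an integer power. *)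
have Hs : H * Num.sqrt (m%:R ^+ 3) <= (2 * pi) ^+ 2.
  have p1 : 1 < 2 * pi :> R by have := pi_ge1; lra.
  have q0 : 0 <= 2 * pi :> R by lra.
  rewrite -(@ler_pXn2r _ 2)// ?nnegrE ?mulr_ge0 ?sqrtr_ge0 ?pi_ge0 ?exprn_ge0 ?(ltW H0)//.
  rewrite exprMn sqr_sqrtr ?exprn_ge0// -H2 -exprMn mesh_mul -exprM.
  by rewrite ler_eXn2l.
rewrite /moment normrM ger0_norm ?exprn_ge0 ?(ltW h0)// H2.
apply: (@le_trans _ _ (H ^+ 2 * (c * (frob X * Num.sqrt (m%:R ^+ 3))))).
  rewrite ler_wpM2l ?exprn_ge0 ?(ltW H0)//.
  apply: le_trans (ler_norm_sum _ _ _) _.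
  apply: le_trans (ler_wpM2l c0 S1); rewrite mulr_sumr.
  by apply: ler_sum => l _; rewrite normrM ler_wpM2r.
have -> : H ^+ 2 * (c * (frob X * Num.sqrt (m%:R ^+ 3))) =
   (c * (H * frob X)) * (H * Num.sqrt (m%:R ^+ 3)) by ring.
have -> : c * (2 * pi) ^+ 2 * (H * frob X) = (c * (H * frob X)) * (2 * pi) ^+ 2 by ring.
by rewrite ler_wpM2l// !mulr_ge0 ?frob_ge0// ltW.
Qed.

End Moments.

(* The moments control [rho] and [temp] uniformly in [m], because the weights
   [1], [v_i] and [|v|^2] are bounded and [h m = 2 pi]. *)
Lemma macro_stable {R : realType} (p : bgk_params R) (rhol Tl CA : R) :
  0 < rhol -> 0 < Tl ->
  exists2 c1 : R, 0 < c1 & forall m (G F : tensor R (3 + 3) m) k, (1 <= m)%N ->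
    maxabs G <= CA -> mesh R m `^ (3 / 2) * frob (G \- F) <= c1 ->
    rhol <= rho G k -> Tl <= temp p G k ->
    rhol / 2 <= rho F k /\ Tl / 2 <= temp p F k.
Proof.
move=> rhol0 Tl0.
(* A common bound for the three kinds of weights [1], [v_i] and [|v|^2]. *)
have [g [g1 g2 g3]] : exists g : R, [/\ 1 <= g, pi <= g & 3 * pi ^+ 2 <= g].
  exists (3 * pi ^+ 2 + pi + 1).
  by have := pi_ge0 R; have := sqr_ge0 (pi : R); split; lra.
have [kap kapE] : exists kap : R, kap = g * (2 * pi) ^+ 2 by eexists.
have kap0 : 0 < kap.
  by rewrite kapE mulr_gt0 ?exprn_gt0 ?mulr_gt0 ?pi_gt0// (lt_le_trans ltr01).
(* The first term bounds the moments of [G]; [kap] leaves room for the perturbation leading to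
   [F]. *)
pose B : R := g * (2 * pi) ^+ 3 * `|CA| + kap.
(* The argument takes place in the space of moment vectors (density, momentum, energy) at one grid
   point. This space does not involve [m], hence neither does the Lipschitz constant [L] of the
   temperature. *)
pose T : Type := (R * ('I_3 -> R) * R)%type.
pose D (x : T) := [/\ rhol / 2 <= x.1.1, `|x.1.1| <= B,
  forall i, `|x.1.2 i| <= B & `|x.2| <= B].
pose dist (x y : T) :=
  `|x.1.1 - y.1.1| + \sum_i `|x.1.2 i - y.1.2 i| + `|x.2 - y.2|.
have dist0 x y : 0 <= dist x y by rewrite !addr_ge0 ?sumr_ge0.
have B0 : 0 <= B.
  rewrite addr_ge0 ?(ltW kap0)// !mulr_ge0// ?exprn_ge0 ?mulr_ge0 ?pi_ge0//.
  exact: le_trans g1.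
have coord (f : T -> R) : (forall x, D x -> `|f x| <= B) ->
    (forall x y, `|f x - f y| <= dist x y) -> bounded_lipschitz D dist f.
  move=> fB fd; exists (B + 1); first by rewrite addr_ge0.
  move=> x y Dx Dy; split; first by rewrite (le_trans (fB _ Dx))// lerDl.
  by rewrite (le_trans (fd x y))// ler_peMl// lerDr.
have b1 : bounded_lipschitz D dist (fun x => x.1.1).
  apply: coord => [x []//|x y]; rewrite /dist -addrA lerDl.
  by rewrite addr_ge0 ?sumr_ge0.
have b2 i : bounded_lipschitz D dist (fun x => x.1.2 i).
  apply: coord => [x []//|x y]; rewrite /dist (bigD1 i)//=.
  by rewrite addrCA -addrA lerDl !addr_ge0 ?sumr_ge0.
have b3 : bounded_lipschitz D dist (fun x => x.2).
  apply: coord => [x []//|x y]; rewrite /dist lerDr.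
  by rewrite addr_ge0 ?sumr_ge0.
pose tau (x : T) := Bo p / 3 * (x.2 / x.1.1 - \sum_i (x.1.2 i / x.1.1) ^+ 2).
have bV : bounded_lipschitz D dist (fun x => x.1.1^-1).
  by apply: (blipV dist0 (a := rhol / 2)) => [|x []|]; rewrite ?divr_gt0.
have [L L0 HL] : bounded_lipschitz D dist tau.
  apply: (blipM (blip_cst dist0 _)); apply: (blipB dist0) => //.
    exact: blipM.
  by apply: blip_sum => // i; apply: blipX => //; exact: blipM.
(* The three summands give [c1 <= 1], [kap * c1 <= rhol / 2] and [L * (5 * kap * c1) <= Tl / 2]. The
   factor 5 counts the moments: one density, three momenta, one energy. *)
pose c1 := (1 + 2 * kap / rhol + 2 * L * (5 * kap) / Tl)^-1.
have a0 : 0 <= 2 * kap / rhol by rewrite !mulr_ge0 ?invr_ge0 ?(ltW kap0) ?(ltW rhol0).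
have a1 : 0 <= 2 * L * (5 * kap) / Tl
  by rewrite !mulr_ge0 ?invr_ge0 ?(ltW kap0) ?(ltW Tl0).
have c10 : 0 < c1 by rewrite invr_gt0 -addrA ltr_pwDl// addr_ge0.
have c1E : c1 + 2 * kap / rhol * c1 + 2 * L * (5 * kap) / Tl * c1 = 1.
  rewrite -{1}[c1]mul1r -!mulrDl mulfV// gt_eqF//.
  by rewrite -invr_gt0.
have k1 : 0 <= 2 * kap / rhol * c1 by rewrite mulr_ge0 ?(ltW c10).
have k2 : 0 <= 2 * L * (5 * kap) / Tl * c1 by rewrite mulr_ge0 ?(ltW c10).
exists c1 => // m G F k m0 GC GF rG TG.
have kc1 : kap * c1 <= rhol / 2.
  have -> : kap * c1 = rhol / 2 * (2 * kap / rhol * c1) by field; rewrite gt_eqF.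
  by rewrite ler_piMr ?divr_ge0// ?(ltW rhol0)//; lra.
have Lc1 : L * (5 * kap * c1) <= Tl / 2.
  have -> : L * (5 * kap * c1) = Tl / 2 * (2 * L * (5 * kap) / Tl * c1).
    by field; rewrite gt_eqF.
  by rewrite ler_piMr ?divr_ge0// ?(ltW Tl0)//; lra.
have kc : kap * c1 <= kap by rewrite ler_piMr ?(ltW kap0)//; lra.
have diff w : (forall l, `|w l| <= g) ->
    `|moment w G k - moment w F k| <= kap * c1.
  move=> wg; rewrite -momentB (le_trans (moment_le_frob m0 _ _ _ _ wg))//.
  by rewrite -kapE ler_wpM2l// ltW.
have bG w : (forall l, `|w l| <= g) -> `|moment w G k| <= B - kap.
  move=> wg; rewrite addrK (le_trans (moment_le_maxabs m0 _ _ _ _ wg))//.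
  rewrite ler_wpM2l// ?(le_trans GC) ?ler_norm//.
  by rewrite mulr_ge0 ?exprn_ge0 ?mulr_ge0 ?pi_ge0// (le_trans _ g1).
have bF w : (forall l, `|w l| <= g) -> `|moment w F k| <= B.
  move=> wg; have := bG _ wg; have := diff _ wg.
  by rewrite !ler_norml => /andP[? ?] /andP[? ?]; apply/andP; split; lra.
have w2 i (l : mindex 3 m) : `|node R l 0 i| <= g.
  by rewrite (le_trans (node_le m0 _ _)).
have w3 (l : mindex 3 m) : `|\sum_i node R l 0 i ^+ 2| <= g.
  by rewrite (le_trans (node_sqr_le m0 _)).
have n1 : `|1| <= g by rewrite normr1.
have rF : rhol / 2 <= rho F k.
  by have := diff _ (fun=> n1); rewrite -!rhoE ler_norml => /andP[? ?]; lra.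
split=> //.
pose x : T := (rho G k, momentum G k, energy G k).
pose y : T := (rho F k, momentum F k, energy F k).
have Dx : D x.
  split=> /=; first by lra.
  - by rewrite rhoE (le_trans (bG _ (fun=> n1)))//; lra.
  - by move=> i; rewrite (le_trans (bG _ (w2 i)))//; lra.
  - by rewrite (le_trans (bG _ w3))//; lra.
have Dy : D y.
  by split=> //= [|i|]; [rewrite rhoE|..]; exact: bF.
have dxy : dist x y <= 5 * kap * c1.
  have -> : 5 * kap * c1 = kap * c1 + \sum_(i < 3) kap * c1 + kap * c1.
    by rewrite sumr_const card_ord; ring.
  rewrite /dist/= !rhoE; apply: lerD; last exact: diff.
  by apply: lerD; [exact: diff|apply: ler_sum => i _; exact: diff].
have [_ txy] := HL _ _ Dx Dy.
have {}txy : `|tau x - tau y| <= Tl / 2.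
  by rewrite (le_trans txy)// (le_trans _ Lc1)// ler_wpM2l.
have [rG0 rF0] : rho G k != 0 /\ rho F k != 0 by split; rewrite gt_eqF//; lra.
move: txy TG; rewrite !tempE// -/(tau x) -/(tau y) ler_norml => /andP[? ?] ?; lra.
Qed.

(** * The collision and transport operators *)

(** The set on which the collision operator is Lipschitz: the lower bounds keep divisions, roots and
    powers away from zero, and the norm bound makes all moments bounded. *)
Definition admissible {R : realType} (p : bgk_params R) {m : nat} (rl tl B : R)
    (F : tensor R (3 + 3) m) : Prop :=
  [/\ forall k, rl <= rho F k, forall k, tl <= temp p F k & frob F <= B].

Section Collision.
Context {R : realType} {p : bgk_params R} {m : nat} {rl tl : R} (B : R).
Hypotheses (Bo_gt0 : 0 < Bo p) (rl_gt0 : 0 < rl) (tl_gt0 : 0 < tl).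

Local Notation adm := (@admissible R p m rl tl B).
Local Notation dist := (fun F G : tensor R (3 + 3) m => frob (F \- G)).
Local Notation blip := (bounded_lipschitz adm dist).

Local Lemma dist_ge0 (F G : tensor R (3 + 3) m) : 0 <= dist F G.
Proof. exact: frob_ge0. Qed.

Lemma blip_moment g k : blip (fun F => moment g F k).
Proof.
apply: blipM (blip_cst dist_ge0 _) _; apply: (blip_sum dist_ge0) => l.
apply: blipM (blip_cst dist_ge0 _) _; exists (`|B| + 1); first by rewrite addr_ge0.
move=> F G [_ _ FB] _; split.
  by rewrite (le_trans (frob_entry _ _))// (le_trans FB)// (le_trans (ler_norm _))// lerDl.
by rewrite (le_trans (frob_entry (F \- G) _))// ler_peMl ?frob_ge0// lerDr.
Qed.

Lemma blip_rho k : blip (fun F => rho F k).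
Proof. by apply: blip_eq (blip_moment (fun=> 1) k) => F _; rewrite rhoE. Qed.

Lemma blip_rhoV k : blip (fun F => (rho F k)^-1).
Proof. by apply: (blipV dist_ge0 rl_gt0 _ (blip_rho k)) => F []. Qed.

Lemma blip_velo k i : blip (fun F => velo F k 0 i).
Proof.
apply: (blip_eq (fun F _ => veloE F k i)); apply: blipM (blip_rhoV k).
exact: blip_moment.
Qed.

Lemma blip_temp k : blip (fun F => temp p F k).
Proof.
have tempF F : adm F -> temp p F k = Bo p / 3 *
    (energy F k / rho F k - \sum_i (momentum F k i / rho F k) ^+ 2).
  by move=> [rF _ _]; apply: tempE; rewrite gt_eqF// (lt_le_trans rl_gt0).
apply: (blip_eq tempF); apply: blipM (blip_cst dist_ge0 _) _.
apply: (blipB dist_ge0); first exact: blipM (blip_moment _ _) (blip_rhoV k).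
apply: (blip_sum dist_ge0) => i; apply: (blipX dist_ge0).
exact: blipM (blip_moment _ _) (blip_rhoV k).
Qed.

Lemma blip_nu k : blip (fun F => nu p F k).
Proof.
apply: blipM; first by apply: blipM (blip_rho k); exact: blip_cst dist_ge0 _.
by apply: (blip_powR dist_ge0 _ tl_gt0 _ (blip_temp k)) => F [].
Qed.

Lemma blip_feq i q : blip (fun F => feq p i F q).
Proof.
have cst := blip_cst dist_ge0; have bT := blip_temp (lsubmx q).
have c0 : 0 < 2 * pi * tl / Bo p by rewrite divr_gt0 ?mulr_gt0 ?pi_gt0.
have cT F : adm F ->
    2 * pi * tl / Bo p <= 2 * pi * temp p F (lsubmx q) / Bo p.
  move=> [_ tF _]; rewrite ler_wpM2r ?invr_ge0 ?(ltW Bo_gt0)//.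
  by rewrite ler_wpM2l// mulr_ge0 ?pi_ge0.
apply: blipM.
  apply: blipM.
    by apply: (blip_powR dist_ge0 _ rl_gt0 _ (blip_rho _)) => F [].
  have bs : blip (fun F => Num.sqrt (2 * pi * temp p F (lsubmx q) / Bo p)).
    apply: (blip_sqrt dist_ge0 c0 cT); apply: blipM (cst _ _).
    exact: blipM (cst _ _) bT.
  apply: (blipV dist_ge0 (a := Num.sqrt (2 * pi * tl / Bo p)) _ _ bs).
    by rewrite sqrtr_gt0.
  by move=> F aF; rewrite ler_wsqrtr// cT.
apply: (blip_expR dist_ge0); apply: (blipN dist_ge0); apply: blipM.
  apply: blipM (cst _ _) _; apply: (blipX dist_ge0); apply: (blipB dist_ge0) => //.
  exact: blip_velo.
apply: (blipV dist_ge0 (a := 2 * tl)); first by rewrite mulr_gt0.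
  by move=> F [_ tF _]; rewrite ler_wpM2l.
exact: blipM (cst _ _) bT.
Qed.

(** The collision term is polynomial in the entries of frequency, equilibrium factors and density.
    Taking these as independent variables lets exact and recompressed factors be compared as two
    points of one ball. *)
Lemma collision_of_lipschitz (b : R) :
  let T : Type := (tensor R 3 m * ('I_3 -> tensor R (3 + 1) m)
                   * tensor R (3 + 3) m)%type in
  exists2 M : R, 0 <= M & forall x y : T,
    [/\ frob x.1.1 <= b, forall i, frob (x.1.2 i) <= b & frob x.2 <= b] ->
    [/\ frob y.1.1 <= b, forall i, frob (y.1.2 i) <= b & frob y.2 <= b] ->
    frob (collision_of p x.1.1 x.1.2 x.2) <= M /\
    frob (collision_of p x.1.1 x.1.2 x.2 \- collision_of p y.1.1 y.1.2 y.2) <=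
      M * (frob (x.1.1 \- y.1.1) + \sum_i frob (x.1.2 i \- y.1.2 i)
           + frob (x.2 \- y.2)).
Proof.
move=> T; pose D (x : T) :=
  [/\ frob x.1.1 <= b, forall i, frob (x.1.2 i) <= b & frob x.2 <= b].
pose dT (x y : T) := frob (x.1.1 \- y.1.1)
  + \sum_i frob (x.1.2 i \- y.1.2 i) + frob (x.2 \- y.2).
have S0 (x y : T) : 0 <= \sum_i frob (x.1.2 i \- y.1.2 i).
  by rewrite sumr_ge0// => i _; exact: frob_ge0.
have dT0 x y : 0 <= dT x y by rewrite !addr_ge0 ?frob_ge0.
have coord (f : T -> R) : (forall x, D x -> `|f x| <= b) ->
    (forall x y, `|f x - f y| <= dT x y) -> bounded_lipschitz D dT f.
  move=> fb fd; exists (`|b| + 1); first by rewrite addr_ge0.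
  move=> x y Dx Dy; split.
    by rewrite (le_trans (fb _ Dx))// (le_trans (ler_norm _))// lerDl.
  by rewrite (le_trans (fd x y))// ler_peMl// lerDr.
apply: (@blip_frob R T D dT _ _ (fun x => collision_of p x.1.1 x.1.2 x.2)) => //.
move=> q; apply: blipM.
  apply: blipM (blip_cst dT0 _) _; apply: coord => [x [xb _ _]|x y].
    exact: le_trans (frob_entry _ _) xb.
  rewrite (le_trans (frob_entry (x.1.1 \- y.1.1) _))// /dT -addrA lerDl.
  by rewrite addr_ge0 ?frob_ge0.
apply: (blipB dT0).
  apply: (blip_prod dT0) => i; apply: coord => [x [_ xb _]|x y].
    exact: le_trans (frob_entry _ _) (xb i).
  rewrite (le_trans (frob_entry (x.1.2 i \- y.1.2 i) _))// /dT (bigD1 i)//=.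
  rewrite addrCA -addrA lerDl !addr_ge0 ?frob_ge0 ?sumr_ge0// => j _.
  exact: frob_ge0.
apply: coord => [x [_ _ xb]|x y]; first exact: le_trans (frob_entry _ _) xb.
rewrite (le_trans (frob_entry (x.2 \- y.2) _))// /dT lerDr.
by rewrite addr_ge0 ?frob_ge0.
Qed.

(** The exact factors at [F] are the intermediate point: Lipschitz continuity compares them with
    those at [G], and the recompression tolerance compares them with the factors in [Q]. *)
Lemma tt_collision_lipschitz : exists2 M : R, 0 <= M &
  forall F G Q eb, adm F -> adm G -> 0 < eb < 1 -> tt_collision p eb F Q ->
  [/\ frob (collision p G \- Q) <= M * (frob (G \- F) + eb),
      frob Q <= M & frob (collision p G) <= M].
Proof.
have [Mn Mn0 Hn] := blip_frob dist_ge0 blip_nu.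
have /choice[Me He] : forall i, exists Me, 0 <= Me /\ forall F G, adm F -> adm G ->
    frob (feq p i F) <= Me /\ frob (feq p i F \- feq p i G) <= Me * dist F G.
  by move=> i; have [Me Me0 He] := blip_frob dist_ge0 (blip_feq i); exists Me.
have Me0 i : 0 <= Me i by have [] := He i.
have S0 : 0 <= \sum_i Me i by rewrite sumr_ge0.
(* The factor 2 is for the recompressed tensors: with [eb < 1] recompression at most doubles the
   bound on the norm. *)
have [M M0 HM] := collision_of_lipschitz (2 * (Mn + \sum_i Me i) + `|B|).
pose C := Mn + \sum_i Me i + 1.
have C1 : 1 <= C by rewrite lerDr addr_ge0.
exists (M * C); first by rewrite mulr_ge0// (le_trans ler01).
move=> F G Q eb aF aG /andP[eb0 eb1] [N [E [[_ HN] HE ->]]].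
have B0 := normr_ge0 B.
have MeS i : Me i <= \sum_i Me i by rewrite (bigD1 i)//= lerDl sumr_ge0.
have rec d (X Y : tensor R d m) b : 0 <= b -> frob X <= b ->
    frob (X \- Y) <= eb * frob X -> frob (X \- Y) <= b * eb /\ frob Y <= 2 * b.
  move=> b0 Xb XY; have XY' : frob (X \- Y) <= b * eb.
    by rewrite (le_trans XY)// mulrC ler_wpM2r// ltW.
  split=> //; have := frob_le_add Y X.
  have : b * eb <= b by rewrite ler_piMr// ltW.
  lra.
have [nF nFG] := Hn _ _ aG aF.
have [n1 n2] := rec _ _ _ _ Mn0 (Hn _ _ aF aF).1 HN.
have fE i := rec _ _ _ _ (Me0 i) ((He i).2 _ _ aF aF).1 (HE i).2.
have normB (X : R) : X <= B -> X <= 2 * (Mn + \sum_i Me i) + `|B|.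
  by move=> XB; have := ler_norm B; lra.
have [HQ HC] : frob (collision_of p N E F) <= M /\
    frob (collision_of p N E F \- collision p G) <=
    M * (frob (N \- nu p G) + \sum_i frob (E i \- feq p i G) + frob (F \- G)).
  move: (HM (N, E, F) (nu p G, fun i => feq p i G, G)) => /=; apply; split=> /=.
  - by lra.
  - by move=> i; have [] := fE i; have := MeS i; lra.
  - by case: aF => _ _; exact: normB.
  - by have [] := Hn _ _ aG aG; lra.
  - by move=> i; have [+ _] := (He i).2 _ _ aG aG; have := MeS i; have := Me0 i; lra.
  - by case: aG => _ _; exact: normB.
have HG : frob (collision p G) <= M.
  move: (HM (nu p G, fun i => feq p i G, G) (nu p G, fun i => feq p i G, G)) => /= H.
  apply: (H _ _).1; split=> /=.
  - by have [] := Hn _ _ aG aG; lra.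
  - by move=> i; have [+ _] := (He i).2 _ _ aG aG; have := MeS i; have := Me0 i; lra.
  - by case: aG => _ _; exact: normB.
  - by have [] := Hn _ _ aG aG; lra.
  - by move=> i; have [+ _] := (He i).2 _ _ aG aG; have := MeS i; have := Me0 i; lra.
  - by case: aG => _ _; exact: normB.
have MMC : M <= M * C by rewrite ler_peMr.
split; [|exact: le_trans MMC|exact: le_trans MMC].
rewrite frob_distC (le_trans HC)// -mulrA ler_wpM2l//.
set e := frob (G \- F).
have hN : frob (N \- nu p G) <= Mn * (e + eb).
  rewrite frob_distC (le_trans (frob_triangle (nu p F) _ _))// mulrDr lerD//.
have hE i : frob (E i \- feq p i G) <= Me i * (e + eb).
  rewrite frob_distC (le_trans (frob_triangle (feq p i F) _ _))// mulrDr lerD//.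
    by have [_] := (He i).2 _ _ aG aF.
  by case: (fE i).
rewrite /C !mulrDl mul1r (frob_distC F) -/e !lerD// ?lerDl ?(ltW eb0)//.
by rewrite mulr_suml; apply: ler_sum => i _; exact: hE.
Qed.

End Collision.

(** * Linear operators on tensors and their norms *)

Definition tensor_linear {R : realType} {d m : nat}
    (S : tensor R d m -> tensor R d m) : Prop :=
  forall a X Y, S (fun i => a * X i + Y i) = fun i => a * S X i + S Y i.

Section Operators.
Context {R : realType} {d m : nat}.
Implicit Types (S : tensor R d m -> tensor R d m) (X Y : tensor R d m).

Lemma tensor_linear0 S : tensor_linear S -> S (fun=> 0) = fun=> 0.
Proof.
move=> SL; have := SL (-1) (fun=> 0) (fun=> 0).
rewrite (_ : (fun i : mindex d m => -1 * 0 + 0) = fun=> 0); last first.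
  by apply/funext => i; rewrite mulr0 addr0.
by move=> ->; apply/funext => i; rewrite mulN1r addNr.
Qed.

Lemma tensor_linearZ S a X : tensor_linear S ->
  S (fun i => a * X i) = fun i => a * S X i.
Proof.
move=> SL; have := SL a X (fun=> 0); rewrite (tensor_linear0 _ SL).
under eq_fun do rewrite addr0; move=> ->.
by apply/funext => i; rewrite addr0.
Qed.

Lemma tensor_linearB S X Y : tensor_linear S -> S (X \- Y) = S X \- S Y.
Proof.
move=> SL; have := SL (-1) Y X; rewrite (_ : (fun i => _) = X \- Y).
  by move=> ->; apply/funext => i /=; ring.
by apply/funext => i /=; ring.
Qed.

(** Assumption (A3) supplies the inverse of [op_minus] as a mere function; its linearity is
    recovered here. *)
Lemma tensor_linear_cancel S S' : cancel S S' -> cancel S' S ->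
  tensor_linear S -> tensor_linear S'.
Proof.
move=> SK S'K SL a X Y; rewrite -[RHS]SK SL !S'K; congr S'.
Qed.

(** Decompose along the unit tensors [e j]; their images bound the operator. This makes the supremum
    defining [opfrob] a genuine one, since [sup] of an unbounded set is the default value 0. *)
Lemma tensor_linear_bounded S : tensor_linear S ->
  exists2 M : R, 0 <= M & forall X, frob (S X) <= M * frob X.
Proof.
move=> SL; pose e (j : mindex d m) : tensor R d m := fun i => (i == j)%:R.
have M0 : 0 <= \sum_j frob (S (e j)).
  by rewrite sumr_ge0// => j _; exact: frob_ge0.
exists (\sum_j frob (S (e j))) => // X.
have XE : X = fun i => \sum_j X j * e j i.
  apply/funext => i; rewrite (bigD1 i)//= /e eqxx mulr1 big1 ?addr0// => j ji.
  by rewrite eq_sym (negbTE ji) mulr0.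
rewrite {1}XE; have : (forall j, `|X j| <= frob X) by exact: frob_entry.
elim: (index_enum _) => [|j s IH] Xj.
  under eq_fun do rewrite big_nil.
  rewrite (tensor_linear0 _ SL) !big_nil mul0r /frob big1 ?sqrtr0// => i _.
  by rewrite expr0n.
under eq_fun do rewrite big_cons.
rewrite SL big_cons mulrDl (le_trans (frobD _ _))// lerD ?IH//.
by rewrite frobZ mulrC ler_wpM2l ?frob_ge0.
Qed.

(** Normalise [X] to a point of the unit ball; for [X] of norm zero, boundedness of [S] gives the
    claim. *)
Lemma opfrob_bound S C X : tensor_linear S -> opfrob S <= C ->
  frob (S X) <= C * frob X.
Proof.
move=> SL SC; have [M M0 SM] := tensor_linear_bounded _ SL.
have [X0|X0] := eqVneq (frob X) 0.
  by have := SM X; rewrite X0 !mulr0.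
have Xp : 0 < frob X by rewrite lt_def X0 frob_ge0.
rewrite -ler_pdivrMr// mulrC -[(frob X)^-1]ger0_norm ?invr_ge0 ?frob_ge0//.
rewrite -frobZ -(tensor_linearZ _ _ _ SL); apply: le_trans SC.
apply: ub_le_sup; last first.
  exists (fun i => (frob X)^-1 * X i) => //=.
  by rewrite frobZ ger0_norm ?invr_ge0 ?frob_ge0// mulVf.
exists M => _ [Y /= Y1 <-]; rewrite (le_trans (SM Y))// ler_piMr//.
Qed.

End Operators.

Lemma transport_linear {R : realType} {m : nat} :
  tensor_linear (@transport R m).
Proof.
move=> a X Y; apply/funext => q; rewrite /transport mulrN -opprD mulr_sumr -big_split/=.
by congr (- _); apply: eq_bigr => i _; ring.
Qed.

Lemma op_minus_linear {R : realType} {m : nat} (dt : R) :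
  tensor_linear (@op_minus R m dt).
Proof.
move=> a X Y; apply/funext => q; rewrite /op_minus transport_linear; ring.
Qed.

(** * Error propagation *)

(** Because the recursion has two steps, the induction carries [e j] and [e j.+1] below the same
    majorant [b j], which satisfies [(1 + 2 * x) * b j + D <= b j.+1]. *)
Lemma discrete_gronwall {R : realFieldType} (e : nat -> R) (x D a : R) (n : nat) :
  0 <= x -> 0 <= D -> 0 <= a -> e 0%N <= a -> e 1%N <= a ->
  (forall j, (1 <= j <= n)%N ->
    e j.+1 <= e j.-1 + x * (e j.-1 + e j) + D) ->
  e n.+1 <= (1 + 2 * x) ^+ n * (a + n%:R * D).
Proof.
move=> x0 D0 a0 e0 e1 erec; pose b j := (1 + 2 * x) ^+ j * (a + j%:R * D).
suff H j : (j <= n)%N -> e j <= b j /\ e j.+1 <= b j by have [] := H n (leqnn n).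
have y1 : 1 <= 1 + 2 * x by rewrite lerDl mulr_ge0.
elim: j => [|j IH] jn; first by rewrite /b expr0 mul1r mul0r addr0.
have [ej ej1] := IH (ltnW jn).
have pj1 : 1 <= (1 + 2 * x) ^+ j.+1 by rewrite exprn_ege1.
have bS : (1 + 2 * x) * b j + D <= b j.+1.
  have -> : b j.+1 = (1 + 2 * x) * b j + (1 + 2 * x) ^+ j.+1 * D.
    by rewrite /b exprS -natr1; ring.
  by rewrite lerD2l ler_peMl.
have bj0 : 0 <= b j.
  by rewrite mulr_ge0 ?exprn_ge0 ?addr_ge0 ?mulr_ge0// (le_trans ler01).
have xb : 0 <= x * b j by rewrite mulr_ge0.
split; first by lra.
have := erec j.+1 jn; rewrite /= => h.
have := ler_wpM2l x0 (lerD ej ej1).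
lra.
Qed.

(** The inverse is applied to the increment [Y - X], not to [Y]: this leaves [frob X] with
    coefficient one plus a multiple of [dt], whereas a product of operator norms could exceed one by
    a fixed amount and ruin the iteration. *)
Lemma leapfrog_error {R : realType} {m : nat} (dt eb ed K L : R)
    (S : tensor R (3 + 3) m -> tensor R (3 + 3) m)
    (G0 Q G2 F0 Q' F2 rhs : tensor R (3 + 3) m) :
  0 <= dt -> 0 <= K -> 0 <= eb ->
  cancel (op_minus dt) S -> (forall X, frob (S X) <= K * frob X) ->
  (forall X : tensor R (3 + 3) m, frob (transport X) <= L * frob X) ->
  op_minus dt G2 = leapfrog_rhs dt G0 Q ->
  frob (leapfrog_rhs dt F0 Q' \- rhs) <= eb * frob (leapfrog_rhs dt F0 Q') ->
  frob (op_minus dt F2 \- rhs) <= ed ->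
  frob (G2 \- F2) <= frob (G0 \- F0) +
    K * (2 * dt * L * frob (G0 \- F0) + 2 * dt * frob (Q \- Q')
         + eb * ((1 + dt * L) * frob F0 + 2 * dt * frob Q') + ed).
Proof.
move=> dt0 K0 eb0 SK SB TB GE Hrhs HF.
set X := G0 \- F0; set Y := G2 \- F2.
(* The transport term arises from [(I + dt L) X - (I - dt L) X = 2 dt L X]. *)
have ZE : op_minus dt (Y \- X) = fun q => 2 * dt * transport X q +
    (2 * dt * (Q \- Q') q +
     ((leapfrog_rhs dt F0 Q' \- rhs) q + -1 * (op_minus dt F2 \- rhs) q)).
  rewrite !(tensor_linearB _ _ _ (op_minus_linear dt)) GE.
  apply/funext => q; rewrite /leapfrog_rhs /op_minus /op_plus /X /=.
  by rewrite (tensor_linearB _ _ _ transport_linear) /=; ring.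
have lf : frob (leapfrog_rhs dt F0 Q') <= (1 + dt * L) * frob F0 + 2 * dt * frob Q'.
  apply: le_trans (frobD _ _) _; rewrite lerD//.
    apply: le_trans (frobD _ _) _; rewrite mulrDl mul1r lerD2l frobZ ger0_norm//.
    by rewrite -mulrA ler_wpM2l.
  by rewrite frobZ ger0_norm ?mulr_ge0.
rewrite (le_trans (frob_le_add Y X))// lerD2l frob_distC -[Y \- X]SK.
rewrite (le_trans (SB _))// ler_wpM2l// ZE.
have dt2 : 0 <= 2 * dt by rewrite mulr_ge0.
rewrite -2!addrA (le_trans (frobD _ _))// lerD//.
  by rewrite frobZ ger0_norm// -mulrA ler_wpM2l.
rewrite (le_trans (frobD _ _))// lerD//.
  by rewrite frobZ ger0_norm.
rewrite (le_trans (frobD _ _))// lerD//.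
  by rewrite (le_trans Hrhs)// ler_wpM2l.
by rewrite frobZ normrN1 mul1r.
Qed.

(** * Error estimates for the whole scheme on a fixed mesh *)

Section Scheme.
Context {R : realType} {p : bgk_params R} {f0 : 'rV[R]_3 -> 'rV[R]_3 -> R}.
Context {tstar rhol Tl CA c1 B : R} {m : nat}.
Hypotheses (Bo_gt0 : 0 < Bo p) (tstar_gt0 : 0 < tstar).
Hypotheses (rhol_gt0 : 0 < rhol) (Tl_gt0 : 0 < Tl) (c1_gt0 : 0 < c1).
Hypothesis m_gt0 : (1 <= m)%N.

Local Notation H := (mesh R m `^ (3 / 2)).

Hypothesis stable : forall (G F : tensor R (3 + 3) m) k,
  maxabs G <= CA -> H * frob (G \- F) <= c1 ->
  rhol <= rho G k -> Tl <= temp p G k ->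
  rhol / 2 <= rho F k /\ Tl / 2 <= temp p F k.

Definition aptt_run (dt eb ed : R) (Ft F : nat -> tensor R (3 + 3) m) : Prop :=
  [/\ [/\ 0 < dt, 0 < eb < 1 & 0 < ed], exact_solution p f0 tstar dt Ft,
      aptt_solution p tstar dt eb ed (Ft 0%N) F,
      macro_lower_bounds p tstar dt rhol Tl Ft
    & uniformly_bounded tstar dt CA Ft /\ step_bounds m dt CA].

(** The first term bounds the norm of the exact solution, the second the error allowed by
    [H * err <= c1]. *)
Hypothesis B_ge : #|mindex (3 + 3) m|%:R * `|CA| + c1 / H <= B.

Local Notation adm := (@admissible R p m (rhol / 2) (Tl / 2) B).

Local Lemma H_gt0 : 0 < H.
Proof. by rewrite powR_gt0// mesh_gt0. Qed.

Local Lemma B_ge0 : 0 <= B.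
Proof.
by rewrite (le_trans _ B_ge)// addr_ge0 ?divr_ge0 ?mulr_ge0 ?(ltW c1_gt0) ?(ltW H_gt0).
Qed.

Lemma frob_subrr (G : tensor R (3 + 3) m) : frob (G \- G) = 0.
Proof.
by rewrite /frob big1 ?sqrtr0// => i _ /=; rewrite subrr expr0n.
Qed.

Lemma admissible_near G F : maxabs G <= CA ->
  (forall k, rhol <= rho G k /\ Tl <= temp p G k) ->
  H * frob (G \- F) <= c1 -> adm F.
Proof.
move=> GC Gk GF; split.
- by move=> k; have [rG tG] := Gk k; have [] := stable _ _ _ GC GF rG tG.
- by move=> k; have [rG tG] := Gk k; have [] := stable _ _ _ GC GF rG tG.
rewrite (le_trans (frob_le_add F G))// (le_trans _ B_ge)// lerD//; last first.
  by rewrite ler_pdivlMr ?H_gt0// mulrC.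
rewrite (le_trans (frob_le_maxabs G))// ler_wpM2l//.
by rewrite (le_trans GC)// ler_norm.
Qed.

Lemma admissible_self G : maxabs G <= CA ->
  (forall k, rhol <= rho G k /\ Tl <= temp p G k) -> adm G.
Proof.
by move=> GC Gk; apply: (admissible_near _ _ GC Gk); rewrite frob_subrr mulr0 ltW.
Qed.

Lemma error_recursion : exists2 C : R, 0 < C & forall dt eb ed Ft F,
  aptt_run dt eb ed Ft F -> forall n, (1 <= n)%N -> n%:R * dt < tstar ->
  let err n := frob (Ft n \- F n) in
  H * err n.-1 <= c1 -> H * err n <= c1 ->
  err n.+1 <= err n.-1 + C * dt * (err n.-1 + err n + eb) + C * (eb + ed).
Proof.
have r2 : 0 < rhol / 2 by rewrite divr_gt0.
have t2 : 0 < Tl / 2 by rewrite divr_gt0.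
have [M M0 HM] := tt_collision_lipschitz B Bo_gt0 r2 t2 (m := m).
have [L L0 HL] := tensor_linear_bounded _ (@transport_linear R m).
have B0 := B_ge0.
have [K [K0 KE]] : exists K, 0 <= K /\ K = `|CA| by exists `|CA|.
(* [P] bounds the norm of the right-hand side before recompression, hence the recompression error by
   [eb * P]. *)
have [P [P0 PE]] : exists P, 0 <= P /\ P = (1 + tstar * L) * B + 2 * tstar * M.
  by eexists; split; last reflexivity; rewrite !(addr_ge0, mulr_ge0)// ltW.
exists (K * (2 * L + 2 * M + P + 1) + 1).
  by rewrite ltr_wpDl// !(addr_ge0, mulr_ge0).
move=> dt eb ed Ft F [[dt0 /andP[eb0 eb1] ed0] [_ _ HFt] [_ _ HF] Hmac
  [Hunif [[S [SK S'K SC]] _]]] n n1 nt err e0 e1.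
(* Since [n] is at least 1, the step cannot exceed the final time; this makes [P] independent of
   [dt]. *)
have dt1 : dt <= tstar.
  by rewrite (le_trans _ (ltW nt))// ler_peMl ?(ltW dt0)// ler1n.
have lev j : (j <= n)%N -> maxabs (Ft j) <= CA /\
    (forall k, rhol <= rho (Ft j) k /\ Tl <= temp p (Ft j) k).
  move=> jn; have jt : j%:R * dt <= tstar.
    by rewrite (le_trans _ (ltW nt))// ler_wpM2r ?(ltW dt0)// ler_nat.
  by split; [exact: Hunif|move=> k; exact: Hmac].
have [u0 v0] := lev n.-1 (leq_pred n); have [u1 v1] := lev n (leqnn n).
have aF0 := admissible_near _ _ u0 v0 e0.
have aF1 := admissible_near _ _ u1 v1 e1.
have aG1 := admissible_self _ u1 v1.
have [Q [rhs [HQ [_ Hrhs] _ Hed]]] := HF n n1 nt.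
have ebb : 0 < eb < 1 by rewrite eb0.
have [HQG Q1 _] := HM _ _ _ _ aF1 aG1 ebb HQ.
have SL : tensor_linear S := tensor_linear_cancel _ _ SK S'K (op_minus_linear dt).
have SB X : frob (S X) <= K * frob X.
  rewrite (le_trans (opfrob_bound _ _ _ SL SC))// ler_wpM2r ?frob_ge0//.
  by rewrite KE ler_norm.
have := leapfrog_error dt eb ed K L S (Ft n.-1) (collision p (Ft n)) (Ft n.+1)
  (F n.-1) Q (F n.+1) rhs (ltW dt0) K0 (ltW eb0) SK SB HL (HFt n n1 nt) Hrhs Hed.
rewrite -!/(err _) => h; apply: le_trans h _; rewrite -[leRHS]addrA lerD2l.
have x0 : 0 <= err n.-1 by exact: frob_ge0.
have y0 : 0 <= err n by exact: frob_ge0.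
have PB : (1 + dt * L) * frob (F n.-1) + 2 * dt * frob Q <= P.
  case: aF0 => _ _ FB; rewrite PE lerD//.
    rewrite ler_pM ?frob_ge0 ?addr_ge0 ?mulr_ge0 ?(ltW dt0)//.
    by rewrite lerD2l ler_wpM2r.
  by rewrite ler_pM ?frob_ge0 ?mulr_ge0 ?(ltW dt0)// ler_wpM2l.
have dt2 : 0 <= 2 * dt by rewrite mulr_ge0// ltW.
have h1 := ler_wpM2l dt2 HQG.
have h2 := ler_wpM2l (ltW eb0) PB.
apply: (@le_trans _ _ (K * (2 * dt * L * err n.-1 + 2 * dt * (M * (err n + eb))
  + eb * P + ed))).
  by rewrite ler_wpM2l// !lerD.
have [KL KM KP] : [/\ 0 <= K * L, 0 <= K * M & 0 <= K * P] by split; rewrite mulr_ge0.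
set x := err n.-1 in x0 *; set y := err n in y0 *.
have nn (c z : R) : 0 <= c -> 0 <= z -> 0 <= c * z by exact: mulr_ge0.
rewrite -subr_ge0.
(* The constant is large enough for the difference of both sides to be a polynomial with nonnegative
   coefficients. *)
have -> : (K * (2 * L + 2 * M + P + 1) + 1) * dt * (x + y + eb)
  + (K * (2 * L + 2 * M + P + 1) + 1) * (eb + ed)
  - K * (2 * dt * L * x + 2 * dt * (M * (y + eb)) + eb * P + ed) =
  (2 * (K * M) + K * P + K + 1) * (dt * x) + (2 * (K * L) + K * P + K + 1) * (dt * (y + eb))
  + (2 * (K * L) + 2 * (K * M) + K + 1) * eb
  + (2 * (K * L) + 2 * (K * M) + K * P + 1) * ed by ring.
rewrite !addr_ge0// nn ?addr_ge0 ?nn ?(ltW eb0) ?(ltW ed0)//.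
all: by rewrite ?addr_ge0 ?nn// ltW.
Qed.

(** An Euler step moves a tensor by [O(dt)], so for small [dt] both stages stay admissible, and each
    stage enlarges the error only by a constant factor. The initial error uses up half of the radius
    [c1], the Euler step the other half. *)
Lemma startup_error : exists dt0 A : R, [/\ 0 < dt0, 0 <= A & forall dt eb ed Ft F,
  aptt_run dt eb ed Ft F -> dt <= dt0 -> dt <= tstar ->
  let err n := frob (Ft n \- F n) in
  H * err 0%N <= c1 / 2 -> err 0%N <= A * eb /\ err 1%N <= A * eb].
Proof.
have r2 : 0 < rhol / 2 by rewrite divr_gt0.
have t2 : 0 < Tl / 2 by rewrite divr_gt0.
have [M M0 HM] := tt_collision_lipschitz B Bo_gt0 r2 t2 (m := m).
have [L L0 HL] := tensor_linear_bounded _ (@transport_linear R m).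
have B0 := B_ge0.
have H0 := H_gt0.
have [s [s0 sE]] : exists s, 0 <= s /\ s = L * B + M.
  by eexists; split; last reflexivity; rewrite !(addr_ge0, mulr_ge0).
have d0 : 0 < 2 * H * s + 1 by rewrite ltr_wpDl// !mulr_ge0// ltW.
have [E [E0 EE]] : exists E, 0 <= E /\ E = B + tstar * (L * B + M * (B + 1)).
  by eexists; split; last reflexivity; rewrite !(addr_ge0, mulr_ge0)// ltW.
pose A := B + (B + E + tstar * (L * E + M * (E + 1))).
have A0 : 0 <= B + E + tstar * (L * E + M * (E + 1)).
  by rewrite !(addr_ge0, mulr_ge0)// ltW.
(* With [s] bounding [transport G + Q], this threshold yields [H * dt * s <= c1 / 2]; the summand 1
   keeps the denominator positive. *)
exists (c1 / (2 * H * s + 1)), A; split; first by rewrite divr_gt0.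
  by rewrite addr_ge0.
move=> dt eb ed Ft F [[dt0 ebb ed0] [_ HFt1 _] [[_ HF0]
  [Q0 [Qh [HQ0 HQh HF1]]] _] Hmac [Hunif _]] dts dtt err e0.
have /andP[eb0 eb1] := ebb.
have t0 : 0%:R * dt <= tstar by rewrite mul0r ltW.
have u0 := Hunif _ t0; have v0 := Hmac _ t0.
have hc : c1 / 2 <= c1 by have := c1_gt0; lra.
have e0' : H * err 0%N <= c1 by exact: le_trans hc.
have aG := admissible_self _ u0 v0.
have aF := admissible_near _ _ u0 v0 e0'.
have [HQG Q0M QGM] := HM _ _ _ _ aF aG ebb HQ0.
have err0 : err 0%N <= B * eb.
  rewrite /err (le_trans HF0)// mulrC ler_wpM2r ?(ltW eb0)//.
  by case: aG.
have euler (G Q : tensor R (3 + 3) m) : adm G -> frob Q <= M ->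
    H * frob (G \- euler_stage dt G Q) <= c1 / 2.
  move=> [_ _ GB] QM.
  have -> : G \- euler_stage dt G Q = fun q => - dt * (transport G q + Q q).
    by apply/funext => q; rewrite /euler_stage/=; ring.
  rewrite frobZ normrN (gtr0_norm dt0).
  have sq : frob (fun q => transport G q + Q q) <= s.
    by rewrite (le_trans (frobD _ _))// sE lerD// (le_trans (HL _))// ler_wpM2l.
  have : dt * (2 * H * s + 1) <= c1 by rewrite -ler_pdivlMr.
  have : H * (dt * frob (fun q => transport G q + Q q)) <= H * (dt * s).
    by rewrite !ler_wpM2l ?(ltW H0) ?(ltW dt0).
  lra.
pose Gh := euler_stage dt (Ft 0%N) (collision p (Ft 0%N)).
pose Fh := euler_stage dt (F 0%N) Q0.
have Gh1 : H * frob (Ft 0%N \- Gh) <= c1 / 2 by exact: euler.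
have aGh : adm Gh by apply: (admissible_near _ _ u0 v0); lra.
have aFh : adm Fh.
  apply: (admissible_near _ _ u0 v0).
  have := ler_wpM2l (ltW H0) (frob_triangle (F 0%N) (Ft 0%N) Fh).
  have := euler _ _ aF Q0M; rewrite -/Fh mulrDr -/(err 0%N); lra.
have [HQh1 _ _] := HM _ _ _ _ aFh aGh ebb HQh.
have tB (X Y : tensor R (3 + 3) m) :
    transport (X \- Y) = transport X \- transport Y.
  exact: tensor_linearB transport_linear.
have hGF : frob (Gh \- Fh) <= E * eb.
  have -> : Gh \- Fh = fun q => (Ft 0%N \- F 0%N) q +
      dt * (transport (Ft 0%N \- F 0%N) q + (collision p (Ft 0%N) \- Q0) q).
    by rewrite tB; apply/funext => q; rewrite /Gh /Fh /euler_stage /=; ring.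
  rewrite (le_trans (frobD _ _))// EE mulrDl lerD// frobZ (gtr0_norm dt0) -mulrA.
  rewrite ler_pM ?frob_ge0 ?(ltW dt0)// (le_trans (frobD _ _))// mulrDl lerD//.
    by rewrite (le_trans (HL _))// -mulrA ler_wpM2l.
  by rewrite (le_trans HQG)// -mulrA ler_wpM2l// mulrDl mul1r lerD2r.
have hQ : frob (collision p Gh \- Qh) <= M * (E + 1) * eb.
  by rewrite (le_trans HQh1)// -mulrA ler_wpM2l// mulrDl mul1r lerD2r.
split.
  by rewrite (le_trans err0)// ler_wpM2r ?(ltW eb0)// lerDl.
(* The Heun error is the mean of the initial error and of the error of an Euler step started at the
   stage. *)
have -> : err 1%N = frob (fun q => 2^-1 * ((Ft 0%N \- F 0%N) q + ((Gh \- Fh) q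
    + dt * (transport (Gh \- Fh) q + (collision p Gh \- Qh) q)))).
  rewrite /err HFt1 HF1 tB -/Gh -/Fh; congr frob; apply/funext => q.
  by rewrite /heun_stage /=; ring.
rewrite frobZ ger0_norm ?invr_ge0//.
have h : frob (fun q => (Ft 0%N \- F 0%N) q + ((Gh \- Fh) q
    + dt * (transport (Gh \- Fh) q + (collision p Gh \- Qh) q))) <=
    (B + E + tstar * (L * E + M * (E + 1))) * eb.
  rewrite (le_trans (frobD _ _))// -addrA mulrDl lerD//.
  rewrite (le_trans (frobD _ _))// mulrDl lerD// frobZ (gtr0_norm dt0) -mulrA.
  rewrite ler_pM ?frob_ge0 ?(ltW dt0)// (le_trans (frobD _ _))// mulrDl lerD//.
  by rewrite (le_trans (HL _))// -mulrA ler_wpM2l.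
have := frob_ge0 (fun q => (Ft 0%N \- F 0%N) q + ((Gh \- Fh) q
    + dt * (transport (Gh \- Fh) q + (collision p Gh \- Qh) q))).
have : 0 <= B * eb by rewrite mulr_ge0// ltW.
rewrite /A mulrDl; lra.
Qed.

(** For [dt <= dt0] the start-up bound and Gronwall apply. For larger [dt] the tolerance is at least
    [dt0^(1 + w)], so it suffices that the error is bounded. *)
Lemma error_bound (w : R) : 0 < w ->
  exists C1 C2 : R, [/\ 0 < C1, 0 < C2 & forall dt Ft F,
    let eps := dt `^ (1 + w) in let err n := frob (Ft n \- F n) in
    aptt_run dt eps eps Ft F -> forall n, (1 <= n)%N -> n%:R * dt < tstar ->
    (forall j, (j <= n)%N -> H * err j <= c1 / 2) ->
    err n.+1 <= C1 * n%:R * eps /\ C1 * n%:R * eps <= C2 * dt `^ w].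
Proof.
move=> w0; have [C C0 HC] := error_recursion.
have [dt0 [A [dt00 A0 HA]]] := startup_error.
have H0 := H_gt0.
have [e0 [e00 e0E]] : exists e0, 0 <= e0 /\ e0 = c1 / H.
  by exists (c1 / H); rewrite divr_ge0// ltW.
(* [E] results from one use of the recursion with both previous errors at most [e0], [dt] at most
   [tstar] and the tolerance at most 1. *)
have [E [E0 EE]] : exists E, 0 <= E /\ E = e0 + C * tstar * (2 * e0 + 1) + C * 2.
  by eexists; split; last reflexivity; rewrite !(addr_ge0, mulr_ge0)// ltW.
have a1 : 0 <= expR (2 * C * tstar) * (A + C * (tstar + 2)).
  by rewrite mulr_ge0 ?expR_ge0// !(addr_ge0, mulr_ge0)// ltW.
have a2 : 0 <= E / dt0 `^ (1 + w) by rewrite divr_ge0// powR_ge0.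
(* The first summand serves small steps, the second large ones, and the third ensures positivity. *)
pose C1 := expR (2 * C * tstar) * (A + C * (tstar + 2)) + E / dt0 `^ (1 + w) + 1.
have C10 : 0 < C1 by rewrite ltr_wpDl// addr_ge0.
exists C1, (C1 * tstar); split=> //; first by rewrite mulr_gt0.
move=> dt Ft F eps err run n n1 nt He.
have [[dtp /andP[eps0 eps1] _] _ _ _ _] := run.
have n1' : 1 <= n%:R :> R by rewrite ler1n.
split; last first.
  have -> : eps = dt * dt `^ w.
    by rewrite /eps powRD ?powRr1 ?(ltW dtp)// gt_eqF ?addr_gt0.
  rewrite mulrA -(mulrA C1) ler_wpM2r ?powR_ge0//.
  by rewrite ler_wpM2l ?(ltW C10)// ltW.
have dtt : dt <= tstar.
  by rewrite (le_trans _ (ltW nt))// ler_peMl ?(ltW dtp).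
have He' j : (j <= n)%N -> H * err j <= c1 by move=> /He /le_trans; apply; have := c1_gt0; lra.
have rec j : (1 <= j <= n)%N ->
    err j.+1 <= err j.-1 + C * dt * (err j.-1 + err j + eps) + C * (eps + eps).
  move=> /andP[j1 jn]; apply: (HC _ _ _ _ _ run) => //.
  - by rewrite (le_lt_trans _ nt)// ler_wpM2r ?(ltW dtp)// ler_nat.
  - by apply: He'; rewrite (leq_trans (leq_pred j)).
  - exact: He'.
have [le|/ltW le] := leP dt dt0.
  have [i0 i1] := HA _ _ _ _ _ run le dtt (He 0%N isT).
  have Cdt : 0 <= C * dt by rewrite mulr_ge0// ltW.
  have D0 : 0 <= C * (tstar + 2) * eps.
    by rewrite !mulr_ge0 ?addr_ge0 ?(ltW C0) ?(ltW tstar_gt0) ?(ltW eps0).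
  have Ae : 0 <= A * eps by rewrite mulr_ge0// ltW.
  have gr := discrete_gronwall err (C * dt) (C * (tstar + 2) * eps) (A * eps) n
    Cdt D0 Ae i0 i1.
  apply: le_trans (gr _) _.
    move=> j jn; apply: le_trans (rec j jn) _.
    have : C * dt * eps <= C * tstar * eps.
      by rewrite ler_wpM2r ?(ltW eps0)// ler_wpM2l// ltW.
    lra.
  have p0 : 0 <= 1 + 2 * (C * dt) by rewrite addr_ge0// mulr_ge0.
  (* The growth factor stays bounded because [n * dt] is below the final time. *)
  have pe : (1 + 2 * (C * dt)) ^+ n <= expR (2 * C * tstar).
    apply: (@le_trans _ _ (expR (2 * (C * dt)) ^+ n)).
      rewrite lerXn2r ?nnegrE ?expR_ge0//.
      exact: expR_ge1Dx.
    rewrite -expRM_natl ler_expR mulr_natl.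
    have := ler_wpM2l (ltW C0) (ltW nt).
    rewrite -mulr_natl; lra.
  (* The start-up error is absorbed into the factor [n], which is at least 1. *)
  have an : A * eps + n%:R * (C * (tstar + 2) * eps) <=
      (A + C * (tstar + 2)) * n%:R * eps.
    have -> : (A + C * (tstar + 2)) * n%:R * eps =
      A * eps * n%:R + n%:R * (C * (tstar + 2) * eps) by ring.
    by rewrite lerD2r ler_peMr.
  have : (1 + 2 * (C * dt)) ^+ n * (A * eps + n%:R * (C * (tstar + 2) * eps)) <=
     expR (2 * C * tstar) * ((A + C * (tstar + 2)) * n%:R * eps).
    by rewrite ler_pM ?exprn_ge0// addr_ge0// mulr_ge0.
  move=> h; apply: le_trans h _.
  rewrite !mulrA ler_wpM2r ?(ltW eps0)// ler_wpM2r//.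
  by rewrite /C1 -addrA lerDl addr_ge0.
have eb j : (j <= n)%N -> err j <= e0.
  by move=> jn; rewrite e0E ler_pdivlMr// mulrC He'.
have nn : (1 <= n <= n)%N by rewrite n1 leqnn.
have ub : err n.+1 <= E.
  apply: le_trans (rec n nn) _.
  have p1 := eb _ (leq_pred n); have p2 := eb _ (leqnn n).
  rewrite EE !lerD//.
    rewrite ler_pM ?mulr_ge0 ?addr_ge0 ?frob_ge0 ?(ltW C0) ?(ltW dtp) ?(ltW eps0)//.
      by rewrite ler_wpM2l ?(ltW C0).
    by lra.
  by rewrite ler_wpM2l ?(ltW C0)//; lra.
apply: le_trans ub _; apply: (@le_trans _ _ (E / dt0 `^ (1 + w) * eps)).
  rewrite mulrAC ler_pdivlMr ?powR_gt0// ler_wpM2l//.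
  by rewrite ge0_ler_powR ?nnegrE ?addr_ge0 ?(ltW dt00) ?(ltW dtp) ?(ltW w0).
rewrite ler_wpM2r ?(ltW eps0)// (@le_trans _ _ C1)//.
  by rewrite /C1 addrAC lerDr addr_ge0.
by rewrite ler_peMr// ltW.
Qed.

End Scheme.

Theorem theorem2 (R : realType) (p : bgk_params R)
    (Kn_gt0 : 0 < Kn p) (Bo_gt0 : 0 < Bo p) (K_gt0 : 0 < Kfreq p)
    (tstar : R) (tstar_gt0 : 0 < tstar)
    (f0 : 'rV[R]_3 -> 'rV[R]_3 -> R)
    (rhol Tl CA : R) (rhol_gt0 : 0 < rhol) (Tl_gt0 : 0 < Tl) :
  exists2 c0 : R, 0 < c0 &
  forall m : nat, (1 <= m)%N ->
  (exists2 C : R, 0 < C &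
    forall (dt eb ed : R) (Ft F : nat -> tensor R (3 + 3) m),
    let err := fun n : nat => frob (Ft n \- F n) in
    0 < dt -> 0 < eb < 1 -> 0 < ed ->
    exact_solution p f0 tstar dt Ft ->
    aptt_solution p tstar dt eb ed (Ft 0%N) F ->
    macro_lower_bounds p tstar dt rhol Tl Ft ->
    uniformly_bounded tstar dt CA Ft ->
    step_bounds m dt CA ->
    forall n : nat, (1 <= n)%N -> n%:R * dt < tstar ->
    (forall j : nat, (n.-1 <= j <= n)%N ->
       mesh R m `^ (3 / 2) * err j <= rhol / 2 /\
       mesh R m `^ (3 / 2) * err j <= c0) ->
    err n.+1 <= err n.-1 + C * dt * (err n.-1 + err n + eb) + C * (eb + ed))
  /\
  (forall w : R, 0 < w ->
   exists C1 C2 : R, [/\ 0 < C1, 0 < C2 &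
    forall (dt eb ed : R) (Ft F : nat -> tensor R (3 + 3) m),
    let err := fun n : nat => frob (Ft n \- F n) in
    0 < dt -> 0 < eb < 1 -> 0 < ed ->
    exact_solution p f0 tstar dt Ft ->
    aptt_solution p tstar dt eb ed (Ft 0%N) F ->
    macro_lower_bounds p tstar dt rhol Tl Ft ->
    uniformly_bounded tstar dt CA Ft ->
    step_bounds m dt CA ->
    eb = dt `^ (1 + w) -> ed = dt `^ (1 + w) ->
    forall n : nat, (1 <= n)%N -> n%:R * dt < tstar ->
    (forall j : nat, (j <= n)%N ->
       mesh R m `^ (3 / 2) * err j <= rhol / 2 /\
       mesh R m `^ (3 / 2) * err j <= c0) ->
    err n.+1 <= C1 * n%:R * dt `^ (1 + w) /\
    C1 * n%:R * dt `^ (1 + w) <= C2 * dt `^ w]).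
Proof.
have [c1 c1_gt0 stable] := macro_stable p rhol Tl CA rhol_gt0 Tl_gt0.
have c1_le : c1 / 2 <= c1 by lra.
(* The recursion works with radius [c1]; the half is required by the start-up step. As [c1] is
   uniform in the mesh, the threshold is fixed before [m]. *)
exists (c1 / 2) => [|m m_gt0]; first by rewrite divr_gt0.
have stable_m (G X : tensor R (3 + 3) m) k := stable m G X k m_gt0.
split.
  have [C C_gt0 HC] := error_recursion (f0 := f0) Bo_gt0 tstar_gt0 rhol_gt0
    Tl_gt0 c1_gt0 m_gt0 stable_m (lexx _).
  exists C => // dt eb ed Ft F err dt_gt0 eb_itv ed_gt0 HFt HF Hmac Hunif Hstep.
  move=> n n_gt0 n_lt Herr; apply: (HC _ _ _ Ft F) => //.
  - by apply: le_trans c1_le; apply: (Herr _ _).2; rewrite leqnn leq_pred.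
  - by apply: le_trans c1_le; apply: (Herr _ _).2; rewrite leqnn leq_pred.
move=> w w_gt0; have [C1 [C2 [C1_gt0 C2_gt0 HC]]] :=
  error_bound (f0 := f0) Bo_gt0 tstar_gt0 rhol_gt0 Tl_gt0 c1_gt0 m_gt0
    stable_m (lexx _) w w_gt0.
exists C1, C2; split=> // dt eb ed Ft F err dt_gt0 eb_itv ed_gt0 HFt HF Hmac
  Hunif Hstep eb_eq ed_eq n n_gt0 n_lt Herr; subst eb ed.
by apply: (HC _ Ft F) => // j /Herr[].
Qed.
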